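(* Let $n\ge 2$ be an integer and $\eta>0$ real. For each row $i=2,\ldots,n$, let $Z_i\sim N_{i-1}(0,I_{i-1})$ and $G_i\sim\chi^2_{n+2\eta-i}$ be independent, with the pairs $(Z_i,G_i)$, $i=2,\ldots,n$, mutually independent across rows, and define $$ Q_i=Z_i^\prime Z_i,\qquad U_i=\frac{Z_i}{Q_i^{1/2}},\qquad R_i^2=\frac{Q_i}{Q_i+G_i}\ (R_i\ge 0),\qquad S_i=(Q_i+G_i)^{1/2}. $$ Let $L$ be the normalized-Bartlett factor built from the same $(Z_i,G_i)$, i.e. $L_{11}=1$, $L_{i,1:i-1}=Z_i^\prime/S_i$, $L_{ii}=G_i^{1/2}/S_i$ for $i=2,\ldots,n$, and $L_{ij}=0$ for $j>i$. Then, for each $i=2,\ldots,n$: (i) $U_i$ is uniform on the unit sphere $\mathbb{S}^{i-2}\subset\mathbb{R}^{i-1}$, $Q_i\sim\chi^2_{i-1}$, and $U_i$ and $Q_i$ are independent; (ii) $R_i^2\sim\operatorname{Beta}\bigl(\frac{i-1}{2},\eta+\frac{n-i}{2}\bigr)$, independent of $U_i$, so the pair $(R_i,U_i)$ has exactly the beta-radius/uniform-direction law used by the extended-onion sampler for row $i$; (iii) the extended-onion row constructed from the radius $R_i$ and direction $U_i$ coincides almost surely with the normalized-Bartlett row: $$ R_iU_i^\prime=\frac{Z_i^\prime}{S_i}=L_{i,1:i-1},\qquad (1-R_i^2)^{1/2}=\frac{G_i^{1/2}}{S_i}=L_{ii}. $$ The couplings are independent across rows $i=2,\ldots,n$, and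 the coupled onion input $(X_i,Y_i)=(Q_i,G_i)$ has the law $\operatorname{Gamma}((i-1)/2,2)\otimes\operatorname{Gamma}(\eta+(n-i)/2,2)$ required by the gamma-ratio construction of the beta radius. Consequently, the gamma-ratio onion sampler driven by $(Q_i,G_i,U_i)_{i=2}^n$ produces the normalized-Bartlett factor $L$ pathwise (almost surely), row by row.
   Context: $\operatorname{Gamma}(\alpha,\theta)$ is the Gamma distribution with shape $\alpha$ and scale $\theta$; for real $a>0$, $\chi^2_a\equiv\operatorname{Gamma}(a/2,2)$. A prime denotes transpose. $\mathbb{S}^{0}=\{-1,1\}$. Extended-onion sampler (row-wise description), with parameters $n,\eta$: $L_{11}=1$, and independently for each row $i=2,\ldots,n$ one takes a random direction $U_i$ uniform on $\mathbb{S}^{i-2}$ and an independent radius $R_i\ge0$ with $R_i^2\sim\operatorname{Beta}\bigl(\frac{i-1}{2},\eta+\frac{n-i}{2}\bigr)$, and sets $L_{i,1:i-1}=R_iU_i^\prime$, $L_{ii}=(1-R_i^2)^{1/2}$, with zeros above the diagonal. The gamma-ratio onion sampler is this sampler with the radius generated as $R_i^2=X_i/(X_i+Y_i)$ from independent inputs $X_i\sim\operatorname{Gamma}((i-1)/2,2)$ and $Y_i\sim\operatorname{Gamma}(\eta+(n-i)/2,2)$, independent of $U_i$; ''driven by $(Q_i,G_i,U_i)$'' means using $X_i=Q_i$, $Y_i=G_i$ and direction $U_i$. *)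

(* Defs.v *)
From HB Require Import structures.
From mathcomp Require Export all_boot all_order all_algebra.
From mathcomp Require Export all_classical all_reals all_analysis.

Set Implicit Arguments.
Unset Strict Implicit.
Unset Printing Implicit Defensive.

Export Order.TTheory GRing.Theory Num.Theory.
Export numFieldNormedType.Exports.

Local Open Scope classical_set_scope.
Local Open Scope ring_scope.

(* Matrices over R carry the sigma-algebra generated by the coordinate maps,
   as the library does for tuples; it is the Borel sigma-algebra. *)
Fact mx_display : measure_display. Proof. exact. Qed.

Section measurable_matrix.
Context {R : realType} (m n : nat).

Definition mx_coord (A : 'M[R]_(m, n)) (ij : 'I_m * 'I_n) : R := A ij.1 ij.2.

Definition measurable_mx : set (set 'M[R]_(m, n)) :=
  <<s \bigcup_ij preimage_set_system setT (mx_coord ^~ ij) measurable >>.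

Let mx_set0 : measurable_mx set0.
Proof. exact: sigma_algebra0. Qed.

Let mx_setC A : measurable_mx A -> measurable_mx (~` A).
Proof. exact: sigma_algebraC. Qed.

Let mx_bigcup (F : (set 'M[R]_(m, n))^nat) :
  (forall i, measurable_mx (F i)) -> measurable_mx (\bigcup_i F i).
Proof. exact: sigma_algebra_bigcup. Qed.

HB.instance Definition _ := @isMeasurable.Build mx_display
  'M[R]_(m, n) measurable_mx mx_set0 mx_setC mx_bigcup.

End measurable_matrix.

Section laws.
Context {R : realType}.
Notation leb := (@lebesgue_measure R).

Definition euler_gamma (a : R) : R :=
  \int[leb]_(x in `]0, +oo[) (x `^ (a - 1) * expR (- x)).

Definition euler_beta (a b : R) : R :=
  \int[leb]_(x in `]0, 1[) (x `^ (a - 1) * (1 - x) `^ (b - 1)).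

(* Shape a, scale t. *)
Definition gamma_density (a t x : R) : R :=
  if 0 < x then x `^ (a - 1) * expR (- (x / t)) / (euler_gamma a * t `^ a)
  else 0.

Definition gamma_law (a t : R) : set R -> \bar R :=
  fun A => (\int[leb]_(x in A) (gamma_density a t x)%:E)%E.

Definition chi2_law (a : R) : set R -> \bar R := gamma_law (a / 2) 2.

(* The library's beta_prob is restricted to natural parameters. *)
Definition beta_density (a b x : R) : R :=
  if 0 < x < 1 then x `^ (a - 1) * (1 - x) `^ (b - 1) / euler_beta a b
  else 0.

Definition beta_law (a b : R) : set R -> \bar R :=
  fun A => (\int[leb]_(x in A) (beta_density a b x)%:E)%E.

(* The m-fold product mu \x ... \x mu on R^m. *)
Fixpoint power_law (mu : set R -> \bar R) (m : nat) : set 'rV[R]_m -> \bar R :=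
  match m with
  | 0 => \d_(0 : 'rV[R]_0)
  | m'.+1 => pushforward (mu \x @power_law mu m')%E
      (fun p : R * 'rV[R]_m' => row_mx (p.1%:M : 'rV[R]_1) p.2 : 'rV[R]_m'.+1)
  end.

Definition std_normal_law (m : nat) : set 'rV[R]_m -> \bar R :=
  @power_law (normal_prob 0 1) m.

Definition lebesgue_rV (m : nat) : set 'rV[R]_m -> \bar R := @power_law leb m.

Definition sqnorm m (z : 'rV[R]_m) : R := (z *m z^T) 0 0.

(* Euclidean unit sphere S^(m-1); the norm of the library on 'rV[R]_m is the
   sup norm. *)
Definition unit_sphere m : set 'rV[R]_m := [set u | sqnorm u = 1].

Definition cone m (A : set 'rV[R]_m) : set 'rV[R]_m :=
  [set t *: u | t in `]0, 1] & u in @unit_sphere m `&` A].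

(* Normalized surface measure of the sphere: the surface measure of a Borel
   subset A of S^(m-1) is m times the volume of the cone over A. For m = 1 this
   puts mass 1/2 on each of the two points of S^0. It is meaningful for 0 < m
   and is seen as a law on the ambient space R^m. *)
Definition sphere_uniform_law (m : nat) : set 'rV[R]_m -> \bar R :=
  fun A => (fine (@lebesgue_rV m (cone A)) /
            fine (@lebesgue_rV m (cone [set: 'rV[R]_m])))%:E.

End laws.
Arguments power_law {R} mu m _.
Arguments std_normal_law {R} m _.
Arguments lebesgue_rV {R} m _.
Arguments sphere_uniform_law {R} m _.

Section random_elements.
Context {R : realType} d (T : measurableType d) (P : probability T R).

Definition has_law d' (T' : measurableType d') (X : T -> T')
    (mu : set T' -> \bar R) : Prop :=
  measurable_fun setT X /\
  forall A : set T', measurable A -> pushforward P X A = mu A.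

Definition independent d1 d2 (T1 : measurableType d1) (T2 : measurableType d2)
    (X : T -> T1) (Y : T -> T2) : Prop :=
  forall (A : set T1) (B : set T2), measurable A -> measurable B ->
    P (X @^-1` A `&` Y @^-1` B) = (P (X @^-1` A) * P (Y @^-1` B))%E.

Definition mutually_independent (I : finType) (D : {pred I}) d'
    (T' : I -> measurableType d') (X : forall i, T -> T' i) : Prop :=
  forall J : {set I}, {subset J <= D} ->
  forall A : forall i, set (T' i), (forall i, measurable (A i)) ->
    P (\bigcap_(i in [set` J]) (X i @^-1` A i)) =
    (\prod_(i in J) P (X i @^-1` A i))%E.

End random_elements.

(* Rows are numbered from 0: the row of index k : 'I_n is row i = k + 1 in the
   usual numbering, so that i = 2, ..., n amounts to 0 < k, the part of the row
   strictly below the diagonal is in R^(i-1) = R^k, and n - i = n - k.+1. *)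
Section factors.
Context {R : realType} (n : nat).

(* Lower triangular matrix whose row k is (v k, e k, 0, ..., 0). *)
Definition lower_factor (v : forall k : 'I_n, 'rV[R]_k) (e : 'I_n -> R) :
    'M[R]_n :=
  \matrix_(k, c)
    if insub (val c) is Some j then v k 0 (j : 'I_k)
    else if c == k then e k else 0.

Definition below_diag (L : 'M[R]_n) (k : 'I_n) : 'rV[R]_k :=
  \row_(j < k) L k (widen_ord (ltnW (ltn_ord k)) j).

Definition onion_factor (r : 'I_n -> R) (u : forall k : 'I_n, 'rV[R]_k) :
    'M[R]_n :=
  lower_factor (fun k => r k *: u k)
    (fun k => if val k == 0%N then 1 else Num.sqrt (1 - r k ^+ 2)).

Definition gamma_ratio_onion_factor (x y : 'I_n -> R)
    (u : forall k : 'I_n, 'rV[R]_k) : 'M[R]_n :=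
  onion_factor (fun k => Num.sqrt (x k / (x k + y k))) u.

Definition bartlett_factor (z : forall k : 'I_n, 'rV[R]_k) (g : 'I_n -> R) :
    'M[R]_n :=
  let s k := Num.sqrt (sqnorm (z k) + g k) in
  lower_factor (fun k => (s k)^-1 *: z k)
    (fun k => if val k == 0%N then 1 else Num.sqrt (g k) / s k).

Definition onion_beta_law (eta : R) (k : 'I_n) : set R -> \bar R :=
  beta_law (k%:R / 2) (eta + (n - k.+1)%:R / 2).

(* Joint law of the radius and the direction of row k. *)
Definition onion_input_law (eta : R) (k : 'I_n) :
    set (R * 'rV[R]_k) -> \bar R :=
  (pushforward (onion_beta_law eta k) Num.sqrt \x sphere_uniform_law k)%E.

Definition gamma_ratio_law (eta : R) (k : 'I_n) : set (R * R) -> \bar R :=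
  (gamma_law (k%:R / 2) 2 \x gamma_law (eta + (n - k.+1)%:R / 2) 2)%E.

(* (X, Y, U) are legitimate inputs of the gamma-ratio onion sampler. *)
Definition gamma_ratio_inputs d (T : measurableType d) (P : probability T R)
    (eta : R) (X Y : 'I_n -> T -> R) (U : forall k : 'I_n, T -> 'rV[R]_k) :
    Prop :=
  (forall k : 'I_n, (0 < k)%N ->
     [/\ has_law P (fun w => (X k w, Y k w)) (gamma_ratio_law eta k),
         has_law P (U k) (sphere_uniform_law k) &
         independent P (fun w => (X k w, Y k w)) (U k)]) /\
  mutually_independent P [pred k : 'I_n | (0 < k)%N]
    (fun k w => (X k w, Y k w, U k w)).

End factors.
Arguments onion_input_law {R} n eta k _.

(* Main.v *)
From HB Require Import structures.
Require Import Defs.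
From mathcomp Require Import measurable_realfun normal_distribution ring lra.

(** The theorem rests on polar coordinates for the Gaussian law and on the
    beta-gamma algebra; the pathwise identities are then algebra on the almost
    sure event where every squared norm and every [G k] is positive.

    Polar coordinates. Write [m] for the dimension, and [sector A] for the set
    of the nonzero [z] whose direction lies in [A]. For a Borel set [A] and a
    nonnegative Borel [f] on the line, [ge0_integral_polar] says that, up to the
    factor [m / 2], the integral of [f (sqnorm z)] over [sector A] is the volume
    of [cone A] times the integral of [s `^ (m / 2 - 1) * f s] over the positive
    half line. This comes from integrating
    [sqnorm z `^ (m / 2) * t `^ (- m / 2 - 1) * f (sqnorm z)] over the pairs
    [(z, t)] with [z] in [sector A] and [sqnorm z <= t], in both orders.
    Integrating in [t] first leaves the integral over the sector.
    Integrating in [z] first, the substitution [z = sqrt t *: z'] moves the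
    domain to the fixed set [cone A], and then [s = t * sqnorm z'] separates the
    variables. So the polar formula only needs Tonelli and the scaling of
    Lebesgue measure.
    For [f] the product of the Gaussian factor [expR (- (s / 2))] and an
    indicator, the formula says that the joint law of direction and squared norm
    is a product up to a constant, and total mass [1] determines the constant:
    neither the volume of the ball nor a value of the Gamma function
    is ever computed. This is [std_normal_polar], and it gives (i).

    Beta-gamma algebra. For independent Gamma variables [x] and [y] with the same
    scale, the substitution [s = x + y], [x = s * v] turns the joint density into
    a function of [s] times the beta kernel of [v = x / (x + y)]
    ([gamma_ratio_weight]). The integral in [s] is the same for all events on
    [v], so total mass eliminates it ([beta_of_gammas]); this gives the law
    of the squared radius.

    Independence. [Q k] and [U k] are independent by the polar decomposition, and
    [G k] is independent of both, so that [U k] is independent of the pair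
    [(Q k, G k)] ([independent_pairl]) and of the radius, which is a function of
    that pair. The objects of row [k] are measurable functions of
    [(Z k, G k)], hence the rows inherit mutual independence. *)

Set Implicit Arguments.
Unset Strict Implicit.
Unset Printing Implicit Defensive.

Local Open Scope classical_set_scope.
Local Open Scope ring_scope.

(** * Measurability of matrix-valued maps *)

Section measurability.
Context d (T : measurableType d) {R : realType}.

Lemma measurable_preimage d' (T' : measurableType d') (f : T -> T') A :
  measurable_fun setT f -> measurable A -> measurable (f @^-1` A).
Proof. by move=> mf mA; rewrite -[X in measurable X]setTI; exact: mf. Qed.

Lemma measurable_mxE m n (i : 'I_m) (j : 'I_n) :
  measurable_fun setT (fun A : 'M[R]_(m, n) => A i j).
Proof.
move=> _ B mB; rewrite setTI; apply: sub_sigma_algebra.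
by exists (i, j) => //; exists B => //; rewrite setTI.
Qed.

Lemma measurable_fun_mx m n (f : T -> 'M[R]_(m, n)) :
  (forall i j, measurable_fun setT (fun x => f x i j)) -> measurable_fun setT f.
Proof.
move=> mf; apply: (@measurability _ _ _ _ _ _ (\bigcup_ij
  preimage_set_system setT (@mx_coord R m n ^~ ij) measurable)) => //.
move=> _ [B [[i j] _ [C mC <-]] <-]; rewrite !setTI.
exact: (measurable_preimage (mf i j)).
Qed.

(** Written as [x * (x ^+ 2) `^ (- 1)], the inverse is a product of measurable
    functions, including at [0], where both sides vanish. *)
Lemma measurable_invr : measurable_fun setT (fun x : R => x^-1).
Proof.
rewrite (_ : (fun _ => _) = fun x : R => x * (x ^+ 2) `^ (- 1)).
  apply: measurable_funM => //.
  by apply: (measurableT_comp (measurable_powR (-1))); exact: measurable_funX.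
apply/funext => x; rewrite powR_inv1 ?sqr_ge0//.
have [->|x0] := eqVneq x 0; first by rewrite invr0 mul0r.
by rewrite expr2 invfM mulVKf.
Qed.

Lemma measurable_sqrt : measurable_fun setT (@Num.sqrt R).
Proof. by apply: nondecreasing_measurable => // x y; exact: ler_wsqrtr. Qed.

Lemma measurable_fun_div (f g : T -> R) : measurable_fun setT f ->
  measurable_fun setT g -> measurable_fun setT (fun x => f x / g x).
Proof.
move=> mf mg; apply: measurable_funM => //.
exact: (measurableT_comp measurable_invr).
Qed.

Lemma measurable_sqnorm m : measurable_fun setT (@sqnorm R m).
Proof.
rewrite /sqnorm; under eq_fun do rewrite mxE.
apply: (@measurable_sum _ _ _ _ _ _ (fun i (z : 'rV[R]_m) => z 0 i * z^T i 0)).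
move=> i; under eq_fun do rewrite mxE.
by apply: measurable_funM; exact: measurable_mxE.
Qed.

Lemma measurable_fun_scale m n (f : T -> R) (g : T -> 'M[R]_(m, n)) :
  measurable_fun setT f -> measurable_fun setT g ->
  measurable_fun setT (fun x => f x *: g x).
Proof.
move=> mf mg; apply: measurable_fun_mx => i j; under eq_fun do rewrite mxE.
by apply: measurable_funM => //; exact: (measurableT_comp (measurable_mxE i j)).
Qed.

End measurability.

(** * Densities, and affine changes of variable on the line *)

Section density.
Context d (T : measurableType d) {R : realType}.
Variables (mu nu : {measure set T -> \bar R}) (g : T -> R).
Hypothesis mg : measurable_fun setT g.
Hypothesis g0 : forall x, 0 <= g x.
Hypothesis nuE : forall A, measurable A -> nu A = (\int[mu]_(x in A) (g x)%:E)%E.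
Import HBNNSimple.
Local Open Scope ereal_scope.

(** The formula holds for indicators by hypothesis, so for nonnegative simple
    functions by linearity, and passes to the limit by monotone convergence. *)
Lemma ge0_integral_density (f : T -> \bar R) : measurable_fun setT f ->
  (forall x, 0 <= f x) -> \int[nu]_x f x = \int[mu]_x (f x * (g x)%:E).
Proof.
move=> mf f0; have mgE : measurable_fun setT (EFin \o g) by exact/measurable_EFinP.
pose h := nnsfun_approx measurableT mf.
have hf x : (EFin \o h n) x @[n --> \oo] --> f x by exact: cvg_nnsfun_approx.
transitivity (limn (fun n => \int[nu]_x (EFin \o h n) x)).
  under eq_integral do rewrite -(cvg_lim _ (hf _))//.
  apply: monotone_convergence => //.
  - by move=> n; apply/measurable_EFinP.
  - by move=> n x _; rewrite lee_fin.
  - by move=> x _ a b ab; rewrite lee_fin; exact/lefP/nd_nnsfun_approx.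
transitivity (limn (fun n => \int[mu]_x ((EFin \o h n) x * (g x)%:E))); last first.
  have hfg x : ((EFin \o h n) x * (g x)%:E) @[n --> \oo] --> f x * (g x)%:E.
    by apply: cvgeZr.
  under [RHS]eq_integral do rewrite -(cvg_lim _ (hfg _))//.
  apply/esym; apply: monotone_convergence => //.
  - by move=> n; apply: emeasurable_funM => //; apply/measurable_EFinP.
  - by move=> n x _; rewrite mule_ge0// lee_fin.
  - move=> x _ a b ab; rewrite lee_wpmul2r// lee_fin//.
    exact/lefP/nd_nnsfun_approx.
congr (limn _); apply/funext => n.
have mI r : measurable (h n @^-1` [set r]) by [].
transitivity (\sum_(r \in range (h n)) \int[nu]_x (r * \1_(h n @^-1` [set r]) x)%:E).
  rewrite -ge0_integral_fsum//.
  - by apply: eq_integral => x _; rewrite fsumEFin// -fimfunE.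
  - by move=> r; exact/measurable_EFinP/measurable_funM.
  - by move=> r x _; rewrite EFinM nnfun_muleindic_ge0.
transitivity (\sum_(r \in range (h n))
    \int[mu]_x ((r * \1_(h n @^-1` [set r]) x)%:E * (g x)%:E)); last first.
  rewrite -ge0_integral_fsum//.
  - apply: eq_integral => x _; rewrite -ge0_mule_fsuml//.
      by rewrite fsumEFin// -fimfunE.
    by move=> r; rewrite EFinM nnfun_muleindic_ge0.
  - move=> r; apply: emeasurable_funM => //.
    exact/measurable_EFinP/measurable_funM.
  - move=> r x _; apply: mule_ge0; last by rewrite lee_fin.
    by rewrite EFinM nnfun_muleindic_ge0.
apply: eq_fsbigr => r /[!inE] -[x _ <-].
have r0 : (0 <= h n x)%R by [].
transitivity ((h n x)%:E * nu (h n @^-1` [set h n x])).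
  under eq_integral do rewrite EFinM.
  rewrite ge0_integralZl//; last exact/measurable_EFinP.
  by rewrite integral_indic// setIT.
under [RHS]eq_integral do rewrite EFinM -muleA.
rewrite ge0_integralZl//; last 2 first.
- by apply: emeasurable_funM => //; exact/measurable_EFinP.
- by move=> y _; rewrite mule_ge0// lee_fin.
rewrite nuE//; congr *%E; rewrite integral_mkcond.
apply: eq_integral => y _; rewrite patchE indicE.
by case: ifPn => _; rewrite ?mul1e ?mul0e.
Qed.
End density.

Section real_line.
Context {R : realType}.

Let idR : measurableTypeR R -> R := idfun.

Let measurable_idR : measurable_fun setT idR.
Proof. exact: (@measurable_id _ (measurableTypeR R)). Qed.

(** [lebesgue_measure] lives on [measurableTypeR R], a copy of [R] whose Borel
    sigma-algebra carries another display; this moves a measure to [R] itself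
    without changing the underlying set function. *)
Definition on_real (mu : set (measurableTypeR R) -> \bar R) : set R -> \bar R :=
  pushforward mu idR.

Section instances.
Variable mu : {sigma_finite_measure set (measurableTypeR R) -> \bar R}.

HB.instance Definition _ := Measure.copy (on_real mu)
  (measure_function_pushforward__canonical__measure_function_Measure
    mu measurable_idR).

Let on_real_sigma_finite : sigma_finite setT (on_real mu).
Proof. by have [F FT Foo] := sigma_finiteT mu; exists F. Qed.

HB.instance Definition _ := Measure_isSigmaFinite.Build _ _ _ (on_real mu)
  on_real_sigma_finite.

Lemma ge0_integral_on_real (D : set R) (f : R -> \bar R) : measurable D ->
  measurable_fun D f -> (forall x, 0 <= f x)%E ->
  (\int[on_real mu]_(x in D) f x = \int[mu]_(x in D) f x)%E.
Proof. by move=> mD mf f0; rewrite ge0_integral_pushforward. Qed.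

End instances.

Definition lebR : set R -> \bar R := on_real (@lebesgue_measure R).
HB.instance Definition _ := SigmaFiniteMeasure.on lebR.

Lemma ge0_integral_lebR (D : set R) (f : R -> \bar R) : measurable D ->
  measurable_fun D f -> (forall x, 0 <= f x)%E ->
  (\int[lebR]_(x in D) f x = \int[lebesgue_measure]_(x in D) f x)%E.
Proof. exact: ge0_integral_on_real. Qed.

End real_line.

Section affine.
Context {R : realType}.
Notation leb := (@lebesgue_measure R).
Local Open Scope ereal_scope.

(** Lebesgue measure is determined by the lengths of intervals, so it suffices
    to compute them after translation; likewise for scaling below. *)
Lemma ge0_integral_shift (c : R) (f : R -> \bar R) :
  measurable_fun setT f -> (forall x, 0 <= f x) ->
  \int[lebR]_x f (c + x)%R = \int[lebR]_x f x.
Proof.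
move=> mf f0.
have mc : measurable_fun setT (fun x : R => (c + x)%R : measurableTypeR R).
  by apply: measurable_funD.
rewrite !ge0_integral_lebR//; last exact: (measurableT_comp mf mc).
have <- : \int[pushforward leb (fun x : R => (c + x)%R : measurableTypeR R)]_x f x =
    \int[leb]_x f (c + x)%R by rewrite ge0_integral_pushforward.
apply: eq_measure_integral => A mA _; apply/esym.
apply: lebesgue_measure_unique mA => _ [[a b]] _ <-.
rewrite /= /pushforward (_ : _ @^-1` _ = `]a - c, b - c]%classic)%R.
  rewrite !lebesgue_measure_itv/= !lte_fin ltrD2r.
  by case: ifP => // _; rewrite -!EFinB opprB addrA subrK.
apply/seteqP; split => x /=; rewrite !in_itv/= ltrBlDl lerBrDl//.
Qed.

Lemma ge0_integral_scale (c : R) (f : R -> \bar R) : (0 < c)%R ->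
  measurable_fun setT f -> (forall x, 0 <= f x) ->
  \int[lebR]_x f (c * x)%R = (c^-1)%:E * \int[lebR]_x f x.
Proof.
move=> c0 mf f0.
have mc : measurable_fun setT (fun x : R => (c * x)%R : measurableTypeR R).
  by apply: measurable_funM.
rewrite !ge0_integral_lebR//; last exact: (measurableT_comp mf mc).
have c0' : (0 <= c)%R by rewrite ltW.
pose k := NngNum c0'.
suff -> : \int[leb]_x f x = c%:E * \int[leb]_x f (c * x)%R.
  by rewrite muleA -EFinM mulVf ?gt_eqF// mul1e.
have <- : \int[pushforward leb (fun x : R => (c * x)%R : measurableTypeR R)]_x f x =
    \int[leb]_x f (c * x)%R by rewrite ge0_integral_pushforward.
rewrite -[c%:E]/(k%:num%:E) -ge0_integral_mscale//.
apply: eq_measure_integral => A mA _.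
apply: lebesgue_measure_unique mA => _ [[a b]] _ <-.
rewrite /= /mscale /= /pushforward (_ : _ @^-1` _ = `]a / c, b / c]%classic)%R.
  rewrite !lebesgue_measure_itv/= !lte_fin ltr_pM2r ?invr_gt0//.
  case: ifP => // _; last by rewrite mule0.
  by rewrite -!EFinB -EFinM -mulrBl mulrCA divff ?gt_eqF// mulr1.
by apply/seteqP; split => x /=; rewrite !in_itv/= ltr_pdivrMr// ler_pdivlMr// mulrC.
Qed.
End affine.

(** * Powers of a measure on the line, as measures on row vectors *)

Section row_cons.
Context {R : realType} (m : nat).

Definition row_cons (p : R * 'rV[R]_m) : 'rV[R]_m.+1 :=
  row_mx (p.1%:M : 'rV[R]_1) p.2.

Definition row_uncons (z : 'rV[R]_m.+1) : R * 'rV[R]_m :=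
  (z 0 0, @rsubmx R 1 1 m z).

Lemma row_consK : cancel row_cons row_uncons.
Proof.
case=> x z; rewrite /row_uncons /row_cons/= row_mxKr; congr pair.
by rewrite -(lshift0 m 0) (@row_mxEl R 1 1 m) mxE.
Qed.

Lemma measurable_row_cons : measurable_fun setT row_cons.
Proof.
apply: measurable_fun_mx => i j.
case: (@split_ordP 1 m j) => k ->.
  under eq_fun do rewrite /row_cons (@row_mxEl R 1 1 m) mxE ord1 (ord1 k) eqxx mulr1n.
  exact: measurable_fst.
under eq_fun do rewrite /row_cons (@row_mxEr R 1 1 m).
exact: (measurableT_comp (measurable_mxE i k)).
Qed.

Lemma measurable_row_uncons : measurable_fun setT row_uncons.
Proof.
apply: measurable_fun_pair; first exact: measurable_mxE.
apply: measurable_fun_mx => i j; under eq_fun do rewrite mxE.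
exact: measurable_mxE.
Qed.

Lemma scale_row_cons t x z : t *: row_cons (x, z) = row_cons (t * x, t *: z).
Proof. by rewrite /row_cons (@scale_row_mx R 1 1 m) scale_scalar_mx. Qed.

Lemma sqnorm_row_cons x z : sqnorm (row_cons (x, z)) = x ^+ 2 + sqnorm z.
Proof.
rewrite /sqnorm /row_cons/= (@tr_row_mx R 1 1 m) (@mul_row_col R 1 1 m 1).
by rewrite mxE tr_scalar_mx -scalar_mxM !mxE eqxx mulr1n expr2.
Qed.

End row_cons.

Section cons_measure.
Context {R : realType} (m : nat).
Variables (mu : {sigma_finite_measure set R -> \bar R}).
Variables (nu : {sigma_finite_measure set 'rV[R]_m -> \bar R}).

Definition cons_measure : set 'rV[R]_m.+1 -> \bar R :=
  pushforward (mu \x nu)%E (@row_cons R m).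

HB.instance Definition _ := Measure.copy cons_measure
  (measure_function_pushforward__canonical__measure_function_Measure
    (mu \x nu)%E (@measurable_row_cons R m)).

(* Rectangles of two exhausting sequences exhaust the product; [row_uncons]
   carries them over to row vectors. *)
Let cons_measure_sigma_finite : sigma_finite setT cons_measure.
Proof.
have /sigma_finiteP[F [FT ndF Foo]] := sigma_finiteT mu.
have /sigma_finiteP[G [GT ndG Goo]] := sigma_finiteT nu.
exists (fun i => @row_uncons R m @^-1` (F i `*` G i)).
  rewrite -preimage_bigcup; apply/seteqP; split => // z _; rewrite /preimage/=.
  case: (row_uncons z) => x y.
  have [i _ Fx] : (\bigcup_i F i) x by rewrite -FT.
  have [j _ Gy] : (\bigcup_i G i) y by rewrite -GT.
  exists (maxn i j) => //; split => /=.
    by move/subsetPset: (ndF _ _ (leq_maxl i j)); exact.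
  by move/subsetPset: (ndG _ _ (leq_maxr i j)); exact.
move=> i; have [mF Fi] := Foo i; have [mG Gi] := Goo i.
have mFG : measurable (F i `*` G i) by exact: measurableX.
split; first exact: (measurable_preimage (@measurable_row_uncons R m)).
rewrite /cons_measure /pushforward (_ : _ @^-1` _ = F i `*` G i).
  by rewrite product_measure1E// lte_mul_pinfty// ge0_fin_numE.
by apply/funext => p; exact: (congr1 (F i `*` G i) (row_consK p)).
Qed.

HB.instance Definition _ := Measure_isSigmaFinite.Build _ _ _ cons_measure
  cons_measure_sigma_finite.

Lemma ge0_integral_cons (f : 'rV[R]_m.+1 -> \bar R) :
  measurable_fun setT f -> (forall z, 0 <= f z)%E ->
  (\int[cons_measure]_z f z = \int[mu]_x \int[nu]_z f (row_cons (x, z)))%E.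
Proof.
move=> mf f0; rewrite ge0_integral_pushforward//; last exact: measurable_row_cons.
rewrite preimage_setT fubini_tonelli1//=.
by apply: measurableT_comp => //; exact: measurable_row_cons.
Qed.

End cons_measure.

Section power_measure.
Context {R : realType} (mu : {sigma_finite_measure set R -> \bar R}).

(** The same recursion as [power_law], but valued in measures: each product is a
    measure only because its second factor is already known to be a sigma-finite
    one. *)
Fixpoint power_measure m : {sigma_finite_measure set 'rV[R]_m -> \bar R} :=
  match m with
  | 0 => \d_(0 : 'rV[R]_0)
  | m'.+1 => cons_measure mu (power_measure m')
  end.

Lemma power_measureE m : power_measure m = power_law mu m :> (set _ -> \bar R).
Proof. by elim: m => //= m <-. Qed.

End power_measure.

Section lebesgue_rV.
Context {R : realType}.
Local Open Scope ereal_scope.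

(** One coordinate at a time, by Tonelli: each contributes a factor [c^-1]. *)
Lemma ge0_integral_rV_scale m (c : R) (f : 'rV[R]_m -> \bar R) : (0 < c)%R ->
  measurable_fun setT f -> (forall x, 0 <= f x) ->
  \int[power_measure lebR m]_z f (c *: z)%R =
  (c ^- m)%:E * \int[power_measure lebR m]_z f z.
Proof.
move=> c0; elim: m f => [|m IH] f mf f0.
  rewrite expr0 invr1 mul1e; apply: eq_integral => z _.
  by rewrite (thinmx0 (c *: z)) (thinmx0 z).
have mc : measurable_fun setT (fun z : 'rV[R]_m.+1 => (c *: z)%R).
  exact: measurable_fun_scale.
have mfr : measurable_fun setT (f \o @row_cons R m).
  by apply: measurableT_comp => //; exact: measurable_row_cons.
rewrite !ge0_integral_cons//; last exact: (measurableT_comp mf mc).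
transitivity (\int[lebR]_x ((c ^- m)%:E *
    \int[power_measure lebR m]_z f (row_cons ((c * x)%R, z)))).
  apply: eq_integral => x _; rewrite -IH//.
    by apply: eq_integral => z _; rewrite scale_row_cons.
  exact: (measurable_fun_pair2 _ mfr).
pose h x := \int[power_measure lebR m]_z f (row_cons (x, z)).
have mh : measurable_fun setT h.
  exact: (measurable_fun_fubini_tonelli_F (m2 := power_measure lebR m) _
    mfr (fun p => f0 _)).
have h0 x : 0 <= h x by apply: integral_ge0.
suff E : \int[lebR]_x ((c ^- m)%:E * h (c * x)%R) =
    (c ^- m.+1)%:E * \int[lebR]_x h x by exact: E.
move: h mh h0 => {mf f0 mc mfr f IH} h mh h0.
have mcx : measurable_fun setT (fun x : R => (c * x)%R).
  by apply: measurable_funM.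
rewrite (@ge0_integralZl _ _ _ lebR setT _ (fun x => h (c * x)%R))//; last 2 first.
- exact: (measurableT_comp mh mcx).
- by rewrite lee_fin invr_ge0 exprn_ge0// ltW.
by rewrite ge0_integral_scale// muleA -EFinM exprSr invfM mulrC.
Qed.

End lebesgue_rV.

(** * The Gaussian density *)

Section normal.
Context {R : realType}.
Local Open Scope ereal_scope.
Notation peak := (normal_peak (1 : R)).

(** The one-dimensional densities multiply because [sqnorm] is additive over
    coordinates. *)
Lemma ge0_integral_std_normal m (f : 'rV[R]_m -> \bar R) :
  measurable_fun setT f -> (forall x, 0 <= f x) ->
  \int[power_measure (on_real (normal_prob 0 1)) m]_z f z =
  (peak ^+ m)%:E *
  \int[power_measure lebR m]_z (f z * (expR (- (sqnorm z / 2)))%:E).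
Proof.
elim: m f => [|m IH] f mf f0.
  rewrite expr0 mul1e; apply: eq_integral => z _.
  by rewrite /sqnorm (thinmx0 z) mul0mx mxE mul0r oppr0 expR0 mule1.
have mfr : measurable_fun setT (f \o @row_cons R m).
  by apply: measurableT_comp => //; exact: measurable_row_cons.
have mE n : measurable_fun setT (fun z : 'rV[R]_n => (expR (- (sqnorm z / 2)))%:E).
  apply/measurable_EFinP/measurableT_comp => //; apply: measurable_funN.
  by apply: measurable_funM => //; exact: measurable_sqnorm.
rewrite !ge0_integral_cons//; last 2 first.
- exact: (emeasurable_funM mf (mE _)).
- by move=> z; rewrite mule_ge0// lee_fin expR_ge0.
have mfE : measurable_fun setT (fun p : R * 'rV[R]_m =>
    f (row_cons p) * (expR (- (sqnorm p.2 / 2)))%:E).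
  by apply: emeasurable_funM => //; exact: (measurableT_comp (mE m)).
have fE0 (p : R * 'rV[R]_m) :
    0 <= f (row_cons p) * (expR (- (sqnorm p.2 / 2)))%:E.
  by rewrite mule_ge0// lee_fin expR_ge0.
pose h x := \int[power_measure lebR m]_z
  (f (row_cons (x, z)) * (expR (- (sqnorm z / 2)))%:E).
have mh : measurable_fun setT h.
  exact: (measurable_fun_fubini_tonelli_F (m2 := power_measure lebR m) _ mfE fE0).
have h0 x : 0 <= h x by apply: integral_ge0 => z _; exact: fE0 (x, z).
have pk0 k : 0 <= (peak ^+ k)%:E by rewrite lee_fin exprn_ge0// normal_peak_ge0.
transitivity (\int[on_real (normal_prob 0 1)]_x ((peak ^+ m)%:E * h x)).
  apply: eq_integral => x _; apply: IH => //.
  exact: (measurable_fun_pair2 _ mfr).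
transitivity ((peak ^+ m.+1)%:E * \int[lebR]_x (h x * (normal_fun 0 1 x)%:E)).
  rewrite (@ge0_integral_density _ _ _ lebR _ (normal_pdf 0 1))//; first last.
  - by move=> x; rewrite mule_ge0.
  - exact: (emeasurable_funM (measurable_cst _) mh).
  - move=> A mA; rewrite ge0_integral_lebR//.
      by apply: measurable_funTS; apply/measurable_EFinP; exact: measurable_normal_pdf.
    by move=> x; rewrite lee_fin normal_pdf_ge0.
  - by move=> x; exact: normal_pdf_ge0.
  - exact: measurable_normal_pdf.
  have mn : measurable_fun setT (fun x : R => (normal_fun 0 1 x)%:E).
    by apply/measurable_EFinP; exact: measurable_normal_fun.
  rewrite -ge0_integralZl//; last 2 first.
  - exact: (emeasurable_funM mh mn).
  - by move=> x _; rewrite mule_ge0// lee_fin normal_fun_ge0.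
  apply: eq_integral => x _; rewrite normal_pdfE ?oner_neq0// exprSr !EFinM.
  by rewrite -!muleA; congr *%E; rewrite muleCA.
congr *%E; apply: eq_integral => x _.
have nx0 : 0 <= (normal_fun 0 1 x)%:E by rewrite lee_fin normal_fun_ge0.
have := ge0_integralZr (power_measure lebR m) measurableT
  (measurable_fun_pair2 x mfE) (fun z _ => fE0 (x, z)) nx0.
rewrite -/(h x) => <-.
apply: eq_integral => z _; rewrite -muleA -EFinM -expRD sqnorm_row_cons.
by rewrite /normal_fun subr0 expr1n; congr (_ * (expR _)%:E)%E; field.
Qed.
End normal.

(** * Directions, sectors and cones *)

Section direction.
Context {R : realType} {m : nat}.
Implicit Types (z : 'rV[R]_m) (A : set 'rV[R]_m).

Definition direction z := (Num.sqrt (sqnorm z))^-1 *: z.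

Definition sector A := [set z | 0 < sqnorm z] `&` direction @^-1` A.

Lemma sqnormE z : sqnorm z = \sum_i z 0 i ^+ 2.
Proof. by rewrite /sqnorm mxE; apply: eq_bigr => i _; rewrite mxE expr2. Qed.

Lemma sqnorm_ge0 z : 0 <= sqnorm z.
Proof. by rewrite sqnormE sumr_ge0// => i _; exact: sqr_ge0. Qed.

Lemma sqnormZ c z : sqnorm (c *: z) = c ^+ 2 * sqnorm z.
Proof.
by rewrite !sqnormE mulr_sumr; apply: eq_bigr => i _; rewrite mxE exprMn.
Qed.

Lemma directionZ c z : 0 < c -> direction (c *: z) = direction z.
Proof.
move=> c0; rewrite /direction sqnormZ sqrtrM ?sqr_ge0// sqrtr_sqr gtr0_norm//.
by rewrite scalerA invfM mulrAC mulVf ?gt_eqF// mul1r.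
Qed.

Lemma sector_scale A c z : 0 < c -> sector A (c *: z) = sector A z.
Proof.
move=> c0; rewrite /sector /preimage/setI/= directionZ// sqnormZ.
by rewrite pmulr_rgt0// exprn_gt0.
Qed.

(** The cone over [A] is the part of the sector in the unit ball: the parameter
    [t] and the point [u] of the sphere are the norm and the direction. *)
Lemma coneE A : cone A = sector A `&` [set z | sqnorm z <= 1].
Proof.
apply/seteqP; split => [_ [t /= +] [u [u1 Au] <-]|z [[/= q0 Az] q1]].
  rewrite in_itv/= => /andP[t0 t1]; move: u1; rewrite /unit_sphere/= => u1.
  rewrite /sector /preimage/setI/= directionZ// sqnormZ u1 mulr1 exprn_gt0//.
  split; last by rewrite expr_le1// ltW.
  by split => //; rewrite /direction u1 sqrtr1 invr1 scale1r.
exists (Num.sqrt (sqnorm z)).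
  by rewrite /= in_itv/= sqrtr_gt0 q0/= -sqrtr1 ler_sqrt.
exists (direction z).
  split => //; rewrite /unit_sphere/= /direction sqnormZ exprVn sqr_sqrtr ?ltW//.
  by rewrite mulVf// gt_eqF.
by rewrite /direction scalerA divff ?scale1r// gt_eqF// sqrtr_gt0.
Qed.

Lemma measurable_direction : measurable_fun setT direction.
Proof.
apply: measurable_fun_scale => //.
apply: (measurableT_comp measurable_invr).
apply: (measurableT_comp measurable_sqrt); exact: measurable_sqnorm.
Qed.

Lemma measurable_sector A : measurable A -> measurable (sector A).
Proof.
move=> mA; apply: measurableI; last exact: measurable_preimage measurable_direction mA.
rewrite (_ : [set z | _] = @sqnorm R m @^-1` `]0, +oo[).
  exact: (measurable_preimage (@measurable_sqnorm R m)).
by apply/seteqP; split => z /=; rewrite in_itv/= andbT.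
Qed.

Lemma measurable_cone A : measurable A -> measurable (cone A).
Proof.
move=> mA; rewrite coneE; apply: measurableI; first exact: measurable_sector.
rewrite (_ : [set z | _] = @sqnorm R m @^-1` `]-oo, 1]).
  exact: (measurable_preimage (@measurable_sqnorm R m)).
by apply/seteqP; split => z /=; rewrite in_itv.
Qed.

End direction.

Section power_tail.
Context {R : realType}.

(** The total [t]-weight when [sqnorm z = 1]; scaling reduces every other [z]
    to this one. *)
Definition power_tail (a : R) : \bar R :=
  (\int[lebR]_t (\1_`[1%R, +oo[ t * t `^ (- a - 1))%:E)%E.

Lemma power_tailE (a : R) : 0 < a -> power_tail a = a^-1%:E.
Proof.
move=> a0; rewrite /power_tail ge0_integral_lebR//; first last.
- by move=> x; rewrite lee_fin mulr_ge0 ?powR_ge0.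
- by apply/measurable_EFinP; apply: measurable_funM.
transitivity (\int[lebesgue_measure]_(t in `[1%R, +oo[) (t `^ (- a - 1))%:E)%E.
  rewrite [RHS]integral_mkcond; apply: eq_integral => t _.
  by rewrite patchE indicE; case: ifP => _; rewrite ?mul1r ?mul0r.
pose F (t : R) := - a^-1 * t `^ (- a).
have dF (x : R) : 0 < x -> is_derive x 1 F (- a^-1 * (- a * x `^ (- a - 1))).
  move=> x0.
  have h := @is_deriveZ R R^o R^o _ (- a^-1) _ _ _ (is_derive1_powR (- a) x0).
  exact: h.
have cpow (x : R) : 0 < x -> {for x, continuous (fun t : R => t `^ (- a - 1))}.
  move=> x0; apply: differentiable_continuous; apply/derivable1_diffP.
  by apply: derivable_powR; rewrite in_itv/= x0.
rewrite (@ge0_continuous_FTC2y _ _ F 1 0).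
- by rewrite /F powR1 mulr1 -EFinB sub0r opprK.
- by move=> x _; exact: powR_ge0.
- apply/continuous_within_itvcyP; split.
    by move=> x; rewrite in_itv/= andbT => x1; exact: cpow (lt_trans ltr01 x1).
  by apply: cvg_at_right_filter; exact: cpow ltr01.
- rewrite -(mulr0 (- a^-1)); apply: cvgMr.
  have lny : (@ln R x) @[x --> +oo%R] --> +oo%R.
    apply/cvgryPge => A; near=> t.
    by rewrite -[A]expRK ler_ln ?posrE ?expR_gt0//; near: t; exact: nbhs_pinfty_ge.
  have cE := cvg_comp _ _ (gt0_cvgMry a0 lny) (@cvgr_expR R).
  apply: cvg_trans (cE _); apply: near_eq_cvg; near=> t.
  by rewrite /powR gt_eqF//= mulNr.
- by move=> x x1; apply: (@ex_derive _ _ _ _ _ _ _ (dF x (lt_trans ltr01 x1))).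
- apply: cvg_at_right_filter; apply: differentiable_continuous.
  by apply/derivable1_diffP; exact: (@ex_derive _ _ _ _ _ _ _ (dF 1 ltr01)).
- move=> x; rewrite in_itv/= andbT => x1.
  rewrite derive1E (@derive_val _ _ _ _ _ _ _ (dF x (lt_trans ltr01 x1))).
  by rewrite mulrA mulrNN mulVf ?gt_eqF// mul1r.
Unshelve. all: by end_near. Qed.
End power_tail.

(** * Integration in polar coordinates *)

Section polar.
Context {R : realType} (m : nat) (A : set 'rV[R]_m) (f : R -> \bar R).
Hypothesis m0 : (0 < m)%N.
Hypothesis mA : measurable A.
Hypothesis mf : measurable_fun setT f.
Hypothesis f0 : forall s, (0 <= f s)%E.

Notation a := (m%:R / 2 : R).
Notation q := (@sqnorm R m).
Notation M := (power_measure (@lebR R) m).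

(* [K] and [H] are the integrand of the double integral before and after the
   substitution [z = sqrt t *: z']. *)
Let E := [set p : 'rV[R]_m * R | q p.1 <= p.2].

Let K (p : 'rV[R]_m * R) : \bar R :=
  ((\1_(sector A) p.1 * q p.1 `^ a * (\1_E p * p.2 `^ (- a - 1)))%:E *
   f (q p.1))%E.

Let H (p : 'rV[R]_m * R) : \bar R :=
  ((\1_(cone A) p.1 * q p.1 `^ a * (\1_`]0%R, +oo[ p.2 * p.2 `^ (a - 1)))%:E *
   f (p.2 * q p.1)%R)%E.

Let mq1 : measurable_fun setT (fun p : 'rV[R]_m * R => q p.1).
Proof. exact: (measurableT_comp (@measurable_sqnorm R m) measurable_fst). Qed.

Let mK : measurable_fun setT K.
Proof.
apply: emeasurable_funM; last exact: (measurableT_comp mf mq1).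
apply/measurable_EFinP; apply: measurable_funM; apply: measurable_funM.
- apply: (measurableT_comp _ measurable_fst); apply: measurable_indic.
  exact: measurable_sector.
- exact: (measurableT_comp (measurable_powR a) mq1).
- apply: measurable_indic.
  rewrite (_ : E = (fun p : 'rV[R]_m * R => p.2 - q p.1) @^-1` `[0, +oo[).
    by apply: measurable_preimage => //; exact: measurable_funB.
  by apply/seteqP; split => p; rewrite /E /= in_itv/= andbT subr_ge0.
- exact: (measurableT_comp (measurable_powR _) measurable_snd).
Qed.

Let mH : measurable_fun setT H.
Proof.
apply: emeasurable_funM; last first.
  by apply: (measurableT_comp mf); exact: measurable_funM.
apply/measurable_EFinP; apply: measurable_funM; apply: measurable_funM.
- apply: (measurableT_comp _ measurable_fst); apply: measurable_indic.
  exact: measurable_cone.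
- exact: (measurableT_comp (measurable_powR a) mq1).
- exact: (measurableT_comp _ measurable_snd).
- exact: (measurableT_comp (measurable_powR _) measurable_snd).
Qed.

Let K0 p : (0 <= K p)%E.
Proof. by rewrite mule_ge0// lee_fin !mulr_ge0// powR_ge0. Qed.

Let H0 p : (0 <= H p)%E.
Proof. by rewrite mule_ge0// lee_fin !mulr_ge0// powR_ge0. Qed.

(* For [t > 0] this is the substitution [z = sqrt t *: z'], under which a sector
   is invariant and the constraint [q z <= t] becomes membership in the ball. For
   [t <= 0] both integrands vanish. *)
Let KH t : (\int[M]_z K (z, t) = \int[M]_z H (z, t))%E.
Proof.
have [t0|t0] := leP t 0.
  apply: eq_integral => z _; rewrite /K /H /= !indicE.
  have -> : (t \in `]0%R, +oo[%classic) = false.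
    by apply/negbTE; rewrite notin_setE/= in_itv/= andbT; apply/negP; rewrite -leNgt.
  rewrite !mul0r !mulr0 mul0e.
  have [/[!inE] -[/= q0 _]|_] := boolP (z \in sector A); last by rewrite !mul0r mul0e.
  rewrite (_ : _ \in E = false) ?mul0r ?mulr0 ?mul0e//.
  apply/negbTE; rewrite notin_setE /E/=; apply/negP; rewrite -ltNge.
  exact: le_lt_trans q0.
pose c := Num.sqrt t.
have c0 : 0 < c by rewrite sqrtr_gt0.
have c2 : c ^+ 2 = t by rewrite sqr_sqrtr// ltW.
have cm : c ^+ m = t `^ a.
  by rewrite -powR_mulrn ?(ltW c0)// /c -powR12_sqrt ?(ltW t0)// -powRrM mulrC.
have mKt : measurable_fun setT (fun z => K (z, t)) by exact: measurable_fun_pair1 mK.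
have Kt0 z : (0 <= K (z, t))%E by exact: K0.
have -> : (\int[M]_z K (z, t) = (c ^+ m)%:E * \int[M]_z K (c *: z, t))%E.
  rewrite (ge0_integral_rV_scale c0 mKt Kt0) muleA -EFinM divff ?mul1e//.
  by rewrite gt_eqF// exprn_gt0.
rewrite -ge0_integralZl//; last 2 first.
- have mc : measurable_fun setT (fun z : 'rV[R]_m => c *: z).
    exact: measurable_fun_scale.
  exact: (measurableT_comp mKt mc).
- by rewrite lee_fin exprn_ge0// ltW.
apply: eq_integral => z _; rewrite /K /H /= muleA -EFinM sqnormZ c2 !indicE.
rewrite coneE in_setI.
congr ((_)%:E * _)%E.
have -> : (c *: z \in sector A) = (z \in sector A).
  by apply/idP/idP; rewrite !inE sector_scale.
have -> : ((c *: z, t) \in E) = (z \in [set z | q z <= 1]).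
  by apply/idP/idP; rewrite !inE /E/= sqnormZ c2 ger_pMr.
have -> : t \in `]0%R, +oo[%classic by rewrite inE/= in_itv/= t0.
rewrite powRM ?sqnorm_ge0 ?(ltW t0)// cm -mulnb natrM mul1r.
set u := (_ \in _)%:R; set v := (_ \in _)%:R.
have -> : t `^ (a - 1) = t `^ a * t `^ a * t `^ (- a - 1).
  rewrite -!powRD ?(gt_eqF t0) ?implybT//; congr (_ `^ _); lra.
ring.
Qed.

(* Substituting [t = q z * t'] moves the domain of integration to [1 <= t']. *)
Let intK z : (\int[lebR]_t K (z, t) =
  power_tail a * ((\1_(sector A) z)%:E * f (q z)))%E.
Proof.
have [/[!inE] zA|zA] := boolP (z \in sector A); last first.
  rewrite indicE (negbTE zA) mul0e mule0; apply: integral0_eq => t _.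
  by rewrite /K/= indicE (negbTE zA) !mul0r mul0e.
have q0 : 0 < q z by case: zA.
pose g t : \bar R := ((\1_`[1%R, +oo[ t * t `^ (- a - 1))%:E)%E.
have mg : measurable_fun setT g by apply/measurable_EFinP; exact: measurable_funM.
have g0 t : (0 <= g t)%E by rewrite lee_fin mulr_ge0// powR_ge0.
have qV0 : 0 < (q z)^-1 by rewrite invr_gt0.
rewrite indicE mem_set// mul1e muleC.
transitivity (\int[lebR]_t (f (q z) * (q z)^-1%:E * g ((q z)^-1 * t)%R))%E.
  apply: eq_integral => t _; rewrite /K /g /= indicE mem_set// mul1r.
  rewrite muleC -muleA -EFinM; congr (_ * _%:E)%E; rewrite !indicE.
  have -> : ((z, t) \in E) = ((q z)^-1 * t \in `[1%R, +oo[%classic).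
    by apply/idP/idP; rewrite !inE/= in_itv/= andbT ler_pdivlMl// mulr1.
  have [|_] := boolP ((q z)^-1 * t \in `[1%R, +oo[%classic);
    last by rewrite !(mul0r, mulr0).
  rewrite inE/= in_itv/= andbT ler_pdivlMl// mulr1 !mul1r => qt.
  have t0 : 0 < t := lt_le_trans q0 qt.
  rewrite powRM ?(ltW qV0) ?(ltW t0)// mulrA; congr (_ * _).
  rewrite -(powR_inv1 (ltW q0)) -powRrM -powRD ?(gt_eqF q0) ?implybT//.
  by congr (_ `^ _); lra.
have mgt : measurable_fun setT (fun t : R => g ((q z)^-1 * t)).
  by apply: (measurableT_comp mg); apply: measurable_funM.
have fq0 : (0 <= f (q z) * (q z)^-1%:E)%E by rewrite mule_ge0// lee_fin ltW.
rewrite (ge0_integralZl lebR measurableT mgt (fun t _ => g0 _) fq0).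
rewrite (ge0_integral_scale qV0 mg g0) -muleA; congr *%E.
by rewrite muleA -EFinM invrK mulVf ?gt_eqF// mul1e.
Qed.

Let I := (\int[lebR]_s ((\1_`]0%R, +oo[ s * s `^ (a - 1))%:E * f s))%E.

(* Substituting [s = q z * t] leaves nothing of [z] but the indicator. *)
Let intH z : (\int[lebR]_t H (z, t) = (\1_(cone A) z)%:E * I)%E.
Proof.
have [/[!inE] zA|zA] := boolP (z \in cone A); last first.
  rewrite indicE (negbTE zA) mul0e; apply: integral0_eq => t _.
  by rewrite /H/= indicE (negbTE zA) !mul0r mul0e.
have q0 : 0 < q z by move: zA; rewrite coneE => -[] [].
pose g s : \bar R := ((\1_`]0%R, +oo[ s * s `^ (a - 1))%:E * f s)%E.
have mg : measurable_fun setT g.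
  by apply: emeasurable_funM => //; apply/measurable_EFinP; exact: measurable_funM.
have g0 s : (0 <= g s)%E by rewrite mule_ge0// lee_fin mulr_ge0// powR_ge0.
rewrite indicE mem_set// mul1e.
transitivity (\int[lebR]_t ((q z)%:E * g (q z * t)%R))%E.
  apply: eq_integral => t _; rewrite /H /g /= indicE mem_set// mul1r.
  rewrite muleA -EFinM [q z * t]mulrC; congr (_%:E * _)%E; rewrite !indicE.
  have -> : (t * q z \in `]0%R, +oo[%classic) = (t \in `]0%R, +oo[%classic).
    by apply/idP/idP; rewrite !inE/= !in_itv/= !andbT pmulr_lgt0.
  have [|_] := boolP (t \in `]0%R, +oo[%classic); last by rewrite !(mul0r, mulr0).
  rewrite inE/= in_itv/= andbT !mul1r => t0.
  rewrite powRM ?(ltW q0) ?(ltW t0)// [t `^ _ * _]mulrC mulrA.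
  by rewrite mulr_powRB1 ?(ltW q0)// divr_gt0// ltr0n.
rewrite ge0_integralZl//; last 2 first.
- by apply: (measurableT_comp mg); apply: measurable_funM.
- by rewrite lee_fin ltW.
by rewrite (ge0_integral_scale q0 mg g0) muleA -EFinM divff ?gt_eqF// mul1e.
Qed.

Lemma ge0_integral_polar :
  (power_tail a * \int[M]_z ((\1_(sector A) z)%:E * f (q z)) =
   M (cone A) *
   \int[lebR]_s ((\1_`]0%R, +oo[ s * s `^ (a - 1))%:E * f s))%E.
Proof.
have mq := @measurable_sqnorm R m.
have mS : measurable_fun setT (fun z => (\1_(sector A) z)%:E * f (q z))%E.
  apply: emeasurable_funM; last exact: (measurableT_comp mf mq).
  by apply/measurable_EFinP/measurable_indic; exact: measurable_sector.
transitivity (\int[M]_z \int[lebR]_t K (z, t))%E.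
  rewrite -ge0_integralZl//.
  - by apply: eq_integral => z _; rewrite intK.
  - by move=> z _; rewrite mule_ge0.
  - by apply: integral_ge0 => t _; rewrite lee_fin mulr_ge0// powR_ge0.
rewrite (fubini_tonelli K mK K0); under eq_integral do rewrite KH.
rewrite -(fubini_tonelli H mH H0); under eq_integral do rewrite intH.
rewrite -/I ge0_integralZr//; first last.
- by apply: integral_ge0 => s _; rewrite mule_ge0// lee_fin mulr_ge0// powR_ge0.
- by apply/measurable_EFinP/measurable_indic; exact: measurable_cone.
by rewrite integral_indic ?setIT//; exact: measurable_cone.
Qed.

End polar.

(** * Gamma laws *)

Section gamma_weight.
Context {R : realType}.
Implicit Types (a : R) (B : set R).

(** The density of Gamma with scale [2] up to its constant, so that no finiteness
    is presupposed. *)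
Definition gamma_kernel a (s : R) : R :=
  \1_`]0%R, +oo[ s * s `^ (a - 1) * expR (- (s / 2)).

Definition gamma_weight a B : \bar R :=
  (\int[lebR]_s (\1_B s * gamma_kernel a s)%:E)%E.

Lemma gamma_kernel_ge0 a s : 0 <= gamma_kernel a s.
Proof. by rewrite !mulr_ge0 ?powR_ge0 ?expR_ge0. Qed.

Lemma gamma_kernel_le0 a s : s <= 0 -> gamma_kernel a s = 0.
Proof.
move=> s0; rewrite /gamma_kernel indicE memNset ?mul0r//= in_itv/= andbT.
by apply/negP; rewrite -leNgt.
Qed.

Lemma measurable_gamma_kernel a : measurable_fun setT (gamma_kernel a).
Proof.
apply: measurable_funM; first exact: measurable_funM.
apply: measurableT_comp => //; apply: measurable_funN.
exact: measurable_funM.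
Qed.

Lemma gamma_weight_ge0 a B : (0 <= gamma_weight a B)%E.
Proof.
by apply: integral_ge0 => s _; rewrite lee_fin mulr_ge0// gamma_kernel_ge0.
Qed.

Lemma gamma_weight_le a B : measurable B ->
  (gamma_weight a B <= gamma_weight a setT)%E.
Proof.
move=> mB; have mg := measurable_gamma_kernel a.
apply: ge0_le_integral => //.
- by move=> s _; rewrite lee_fin mulr_ge0// gamma_kernel_ge0.
- by apply/measurable_EFinP; apply: measurable_funM => //; exact: measurable_indic.
- by apply/measurable_EFinP; apply: measurable_funM => //; exact: measurable_indic.
- move=> s _; rewrite lee_fin ler_wpM2r ?gamma_kernel_ge0//.
  by rewrite !indicE in_setT; case: (_ \in _).
Qed.

(** This survives at infinite [x]: [fine] sends both infinities, as well as their
    product with [0], to [0]. *)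
Lemma fineMl (r : R) (x : \bar R) : fine (r%:E * x)%E = r * fine x.
Proof.
case: x => //=; rewrite ?mulr0.
- by rewrite mulr_infty/=; case: sgrP; rewrite ?mul0e ?mul1e ?EFinN ?mulN1e.
- by rewrite mulr_infty/=; case: sgrP; rewrite ?mul0e ?mul1e ?EFinN ?mulN1e.
Qed.

Lemma gamma_weightT a : fine (gamma_weight a setT) = euler_gamma a * 2 `^ a.
Proof.
have mg := measurable_gamma_kernel a.
have mG : measurable_fun setT (fun s => (gamma_kernel a s)%:E).
  exact/measurable_EFinP.
have G0 s : (0 <= (gamma_kernel a s)%:E)%E by rewrite lee_fin gamma_kernel_ge0.
have -> : gamma_weight a setT = (\int[lebR]_s (gamma_kernel a s)%:E)%E.
  by apply: eq_integral => s _; rewrite indicT mul1r.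
have t0 : (0 : R) < 2 by [].
have h0 (x : R) : 0 <= \1_`]0, +oo[ x * (x `^ (a - 1) * expR (- x)).
  by rewrite !mulr_ge0 ?powR_ge0 ?expR_ge0.
have mh : measurable_fun setT
    (fun x : R => \1_`]0, +oo[ x * (x `^ (a - 1) * expR (- x))).
  apply: measurable_funM => //; apply: measurable_funM => //.
  by apply: measurableT_comp => //; exact: measurable_funN.
have := ge0_integral_scale t0 mG G0.
rewrite (_ : (\int[lebR]_x _ = (2 `^ (a - 1))%:E *
   \int[lebR]_x (\1_`]0, +oo[ x * (x `^ (a - 1) * expR (- x)))%:E)%E); last first.
  rewrite -ge0_integralZl//.
  - apply: eq_integral => x _; rewrite -EFinM; congr (_%:E).
    rewrite /gamma_kernel [2 * x]mulrC mulfK// !indicE.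
    have -> : (x * 2 \in `]0%R, +oo[%classic) = (x \in `]0%R, +oo[%classic).
      by apply/idP/idP; rewrite !inE/= !in_itv/= !andbT pmulr_lgt0.
    have [|_] := boolP (x \in `]0%R, +oo[%classic); last by rewrite !(mul0r, mulr0).
    rewrite inE/= in_itv/= andbT !mul1r => x0.
    by rewrite powRM ?(ltW x0)// [x `^ _ * _]mulrC mulrA.
  - exact/measurable_EFinP.
  - by move=> x _; rewrite lee_fin.
move/(congr1 (fun x => fine (2%:E * x)%E)).
rewrite [in RHS]muleA -EFinM divff// mul1e => <-.
rewrite !fineMl mulrA mulrC; congr (_ * _); last first.
  have -> : (2 : R) `^ a = 2 `^ (a - 1 + 1) by rewrite subrK.
  by rewrite [RHS]powRD ?pnatr_eq0 ?implybT// powRr1// mulrC.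
rewrite /euler_gamma /Rintegral; congr fine.
rewrite ge0_integral_lebR//; last exact/measurable_EFinP.
rewrite [RHS]integral_mkcond; apply: eq_integral => x _.
by rewrite patchE indicE; case: ifP => _; rewrite ?mul1r ?mul0r.
Qed.

Lemma gamma_densityE a x :
  gamma_density a 2 x = gamma_kernel a x / fine (gamma_weight a setT).
Proof.
rewrite gamma_weightT /gamma_density /gamma_kernel indicE.
case: ifPn => x0; last by rewrite memNset ?mul0r//= in_itv/= andbT; exact/negP.
by rewrite mem_set ?mul1r//= in_itv/= x0.
Qed.

(** The normalizing constant of [gamma_law] is the total weight itself, even if
    the latter is infinite: then both sides have constant [0]. *)
Lemma gamma_lawE a B : measurable B ->
  gamma_law a 2 B = (gamma_weight a B * (fine (gamma_weight a setT))^-1%:E)%E.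
Proof.
move=> mB; have mg := measurable_gamma_kernel a.
set C := (fine _)^-1.
have C0 : 0 <= C by rewrite invr_ge0 fine_ge0// gamma_weight_ge0.
rewrite /gamma_law -ge0_integral_lebR//; last 2 first.
- under eq_fun do rewrite gamma_densityE -/C.
  by apply: measurable_funTS; apply/measurable_EFinP; exact: measurable_funM.
- by move=> x; rewrite gamma_densityE lee_fin mulr_ge0// gamma_kernel_ge0.
rewrite integral_mkcond -ge0_integralZr//; last 2 first.
- by apply/measurable_EFinP; apply: measurable_funM => //; exact: measurable_indic.
- by move=> s _; rewrite lee_fin mulr_ge0// gamma_kernel_ge0.
apply: eq_integral => s _; rewrite patchE indicE gamma_densityE -/C.
by case: ifP => _; rewrite ?mul1r ?mul0r ?mul0e// EFinM.
Qed.

End gamma_weight.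

(** * Polar decomposition of the Gaussian law *)

Section ereal_normalization.
Context {R : realType}.

Lemma mule_eq_fin_gt0 (X Y : \bar R) (c : R) : (0 <= X)%E -> (0 <= Y)%E ->
  0 < c -> (X * Y)%E = c%:E -> exists2 r : R * R, 0 < r.1 /\ 0 < r.2 &
  X = r.1%:E /\ Y = r.2%:E.
Proof.
case: X Y => [x||] [y||]//; rewrite ?lee_fin ?leNye ?mulyy//.
- move=> x0 y0 c0; rewrite -EFinM => -[xy]; exists (x, y) => //=.
  rewrite !lt_neqAle x0 y0 !andbT ![0 == _]eq_sym.
  by move: c0; rewrite -xy lt_neqAle eq_sym mulf_eq0 negb_or => /andP[/andP[]].
- rewrite le_eqVlt => /orP[/eqP<-|x0] _ c0; last by rewrite gt0_muley.
  by rewrite mul0e => -[] c0'; rewrite -c0' ltxx in c0.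
- move=> _; rewrite le_eqVlt => /orP[/eqP<-|y0] c0; last by rewrite gt0_mulye.
  by rewrite mule0 => -[] c0'; rewrite -c0' ltxx in c0.
Qed.

(** The elimination of unknown constants by total mass: [a] is the total of a
    product weight and [a * n] the weight of one event, so [n] is the product of
    the normalized factors. Positivity of [a] forces the totals [X] and [Y] to be
    positive and finite. *)
Lemma normalized_product (p a : R) (x X n y Y : \bar R) :
  (x <= X)%E -> (y <= Y)%E -> (0 <= y)%E -> (0 <= x)%E -> (0 <= X)%E ->
  (0 <= Y)%E -> (0 <= n)%E -> (n <= 1)%E -> 0 < p -> 0 < a ->
  a%:E = (p%:E * (X * Y))%E -> (a%:E * n)%E = (p%:E * (x * y))%E ->
  n = ((fine x / fine X)%:E * (y * ((fine Y)^-1)%:E))%E.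
Proof.
move=> xX yY y0 x0 X0 Y0 n0 n1 p0 a0 eT eA.
have XYE : (X * Y)%E = (p^-1 * a)%:E.
  by rewrite EFinM eT muleA -EFinM mulVf ?gt_eqF// mul1e.
have pa0 : 0 < p^-1 * a by rewrite mulr_gt0// invr_gt0.
have [[u v] [/= u0 v0] [XE YE]] := mule_eq_fin_gt0 X0 Y0 pa0 XYE.
move: xX yY y0 x0 n0 n1 eT eA; rewrite XE YE {XYE XE YE X0 Y0}.
case: x => [x||]//; case: y => [y||]//; case: n => [n||]//.
move=> _ _ _ _ _ _; rewrite -!EFinM => -[aE] -[nE]; congr (_%:E) => /=.
apply: (mulfI (lt0r_neq0 a0)); rewrite nE aE; field.
by rewrite !gt_eqF.
Qed.

End ereal_normalization.

Section normal_polar.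
Context {R : realType}.
Notation N := (power_measure (on_real (normal_prob (0 : R) 1))).
Notation M := (power_measure (@lebR R)).
Notation q := (@sqnorm R _).

Lemma std_normal_setT m : N m setT = 1%E.
Proof.
elim: m => [|m IH]; first exact: diracT.
rewrite [LHS]/= /cons_measure /pushforward preimage_setT -setXTT.
by rewrite product_measure1E// IH mule1; exact: probability_setT.
Qed.

(** The complement of the full sector is the origin, which lies in the null
    hyperplane where the first coordinate vanishes; this is where the dimension
    has to be positive. *)
Lemma std_normal_sector m : (0 < m)%N -> N m (sector setT) = 1%E.
Proof.
case: m => // m _.
have mS := @measurable_sector R m.+1 _ measurableT.
have mZ : measurable [set z : 'rV[R]_m.+1 | z 0 0 = 0].
  exact: (measurable_preimage (@measurable_mxE R 1 m.+1 0 0) (measurable_set1 0)).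
have NZ : N m.+1 [set z | z 0 0 = 0] = 0%E.
  rewrite /= /cons_measure /pushforward.
  rewrite (_ : _ @^-1` _ = [set 0] `*` setT); last first.
    have e x (z : 'rV[R]_m) : row_cons (x, z) 0 0 = x.
      by have /(congr1 fst) := row_consK (x, z).
    by apply/seteqP; split => -[x z]; rewrite /= e => // -[].
  rewrite product_measure1E// [X in (X * _)%E](_ : _ = 0%E) ?mul0e//.
  exact: integral_set1.
apply/eqP; rewrite eq_le; apply/andP; split.
  by rewrite -(std_normal_setT m.+1) le_measure ?inE.
rewrite -(std_normal_setT m.+1) -[X in (_ <= X)%E]adde0 -NZ.
apply: le_trans (measureU2 _ mS mZ); apply: le_measure; rewrite ?inE//.
  exact: measurableU.
move=> z _; have [q0|q0] := ltP 0 (sqnorm z); first by left.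
right => /=; have : sqnorm z == 0 by rewrite eq_le q0 sqnorm_ge0.
rewrite sqnormE psumr_eq0; last by move=> i _; exact: sqr_ge0.
by move=> /allP/(_ 0); rewrite mem_index_enum sqrf_eq0 => /(_ isT)/eqP.
Qed.

Lemma std_normal_setI_sector m (X : set 'rV[R]_m) : (0 < m)%N -> measurable X ->
  N m (X `&` sector setT) = N m X.
Proof.
move=> m0 mX; have mS := @measurable_sector R m _ measurableT.
have X1 : (N m (X `\` sector setT) <= 0)%E.
  have -> : 0%E = N m (~` sector setT).
    have : (N m setT = N m (setT `\` sector setT) + N m (setT `&` sector setT))%E.
      exact: measureDI.
    rewrite setTI setTD std_normal_sector// std_normal_setT.
    have : (0 <= N m (~` sector setT))%E by [].
    case: (N m (~` _)) => [r||]//= _ [/eqP].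
    by rewrite -subr_eq subrr => /eqP <-.
  apply: le_measure; rewrite ?inE; [exact: measurableD|exact: measurableC|].
  by move=> z [].
have -> : (N m X = N m (X `\` sector setT) + N m (X `&` sector setT))%E.
  exact: measureDI.
rewrite (_ : N m (X `\` _) = 0%E) ?add0e//.
by apply/eqP; rewrite eq_le X1/=.
Qed.

Lemma std_normal_polar_weight m (A : set 'rV[R]_m) (B : set R) : (0 < m)%N ->
  measurable A -> measurable B ->
  ((m%:R / 2)^-1%:E * N m (sector A `&` q @^-1` B) =
   (normal_peak 1 ^+ m)%:E * (M m (cone A) * gamma_weight (m%:R / 2) B))%E.
Proof.
move=> m0 mA mB; have mq := @measurable_sqnorm R m.
have mS := measurable_sector mA.
have mqB := measurable_preimage mq mB.
pose f (s : R) : \bar R := (\1_B s * expR (- (s / 2)))%:E.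
have mf : measurable_fun setT f.
  apply/measurable_EFinP; apply: measurable_funM; first exact: measurable_indic.
  apply: measurableT_comp => //; apply: measurable_funN.
  exact: measurable_funM.
have f0 s : (0 <= f s)%E by rewrite lee_fin mulr_ge0// expR_ge0.
have := ge0_integral_polar m0 mA mf f0.
rewrite power_tailE; last by rewrite divr_gt0// ltr0n.
rewrite (_ : (\int[lebR]_s _)%E = gamma_weight (m%:R / 2) B); last first.
  apply: eq_integral => s _; rewrite -EFinM /gamma_kernel; congr (_%:E); ring.
move=> <-; rewrite muleCA; congr (_ * _)%E.
have mSB : measurable (sector A `&` q @^-1` B) by exact: measurableI.
have -> : N m (sector A `&` q @^-1` B) =
    (\int[N m]_z (\1_(sector A `&` q @^-1` B) z)%:E)%E.
  by rewrite integral_indic// setIT.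
rewrite ge0_integral_std_normal//; last first.
  exact/measurable_EFinP/measurable_indic.
congr (_ * _)%E; apply: eq_integral => z _.
rewrite /f -!EFinM; congr (_%:E); rewrite mulrA; congr (_ * _).
rewrite !indicE in_setI -mulnb natrM; congr (_ * (_ _)%:R).
Qed.

(** Comparison with the case where [A] and [B] are full eliminates the factor
    [m / 2], the Gaussian constant, the volume of the ball and the total radial
    weight. *)
Lemma std_normal_polar m (A : set 'rV[R]_m) (B : set R) : (0 < m)%N ->
  measurable A -> measurable B ->
  N m (direction @^-1` A `&` q @^-1` B) =
  (sphere_uniform_law m A * chi2_law m%:R B)%E.
Proof.
move=> m0 mA mB.
have -> : N m (direction @^-1` A `&` q @^-1` B) = N m (sector A `&` q @^-1` B).
  rewrite -std_normal_setI_sector//; last first.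
    apply: measurableI; first exact: measurable_preimage (@measurable_direction R m) mA.
    exact: measurable_preimage (@measurable_sqnorm R m) mB.
  by congr (N m _); apply/seteqP; split => z /=; rewrite /sector/=; tauto.
rewrite /chi2_law gamma_lawE// /sphere_uniform_law.
have -> : lebesgue_rV m = M m :> (set 'rV[R]_m -> \bar R).
  by rewrite power_measureE.
have := std_normal_polar_weight m0 mA mB.
have := std_normal_polar_weight m0 measurableT measurableT.
rewrite preimage_setT setIT std_normal_sector// mule1.
have p0 : 0 < normal_peak (1 : R) ^+ m by rewrite exprn_gt0// normal_peak_gt0// oner_neq0.
have a0 : 0 < (m%:R / 2 : R)^-1 by rewrite invr_gt0 divr_gt0// ltr0n.
have VA : (M m (cone A) <= M m (cone setT))%E.
  apply: le_measure; rewrite ?inE; [exact: measurable_cone|exact: measurable_cone|].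
  by rewrite !coneE => z [[? _] ?].
have JB := gamma_weight_le (m%:R / 2) mB.
have JB0 := gamma_weight_ge0 (m%:R / 2) B.
have VA0 : (0 <= M m (cone A))%E by [].
have VT0 : (0 <= M m (cone setT))%E by [].
have JT0 := gamma_weight_ge0 (m%:R / 2) (setT : set R).
have NA0 : (0 <= N m (sector A `&` q @^-1` B))%E by [].
have NA1 : (N m (sector A `&` q @^-1` B) <= 1)%E.
  rewrite -(std_normal_setT m); apply: le_measure; rewrite ?inE//.
  apply: measurableI; first exact: measurable_sector.
  exact: measurable_preimage (@measurable_sqnorm R m) mB.
move: VA JB JB0 VA0 VT0 JT0 NA0 NA1 p0 a0.
move: (M m (cone A)) (M m (cone setT)) (N m _) (gamma_weight _ B) (gamma_weight _ setT).
move: (normal_peak 1 ^+ m) (m%:R / 2)^-1 => p a x X n y Y.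
exact: normalized_product.
Qed.
End normal_polar.

(** * Beta laws *)

Section beta_weight.
Context {R : realType} (a b : R).
Implicit Types (B : set R).

Definition beta_kernel (v : R) : R :=
  \1_`]0%R, 1%R[ v * (v `^ (a - 1) * (1 - v) `^ (b - 1)).

Definition beta_weight B : \bar R :=
  (\int[lebR]_v (\1_B v * beta_kernel v)%:E)%E.

Lemma beta_kernel_ge0 v : 0 <= beta_kernel v.
Proof. by rewrite !mulr_ge0 ?powR_ge0. Qed.

Lemma measurable_beta_kernel : measurable_fun setT beta_kernel.
Proof.
apply: measurable_funM => //; apply: measurable_funM => //.
by apply: (measurableT_comp (measurable_powR (b - 1))); exact: measurable_funB.
Qed.

Let measurable_indic_kernel B : measurable B ->
  measurable_fun setT (fun v => (\1_B v * beta_kernel v)%:E).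
Proof.
move=> mB; apply/measurable_EFinP; apply: measurable_funM.
  exact: measurable_indic.
exact: measurable_beta_kernel.
Qed.

Lemma beta_weight_ge0 B : (0 <= beta_weight B)%E.
Proof.
by apply: integral_ge0 => s _; rewrite lee_fin mulr_ge0// beta_kernel_ge0.
Qed.

Lemma beta_weight_le B : measurable B -> (beta_weight B <= beta_weight setT)%E.
Proof.
move=> mB; apply: ge0_le_integral => //.
- by move=> s _; rewrite lee_fin mulr_ge0// beta_kernel_ge0.
- exact: measurable_indic_kernel.
- exact: measurable_indic_kernel.
- move=> s _; rewrite lee_fin ler_wpM2r ?beta_kernel_ge0//.
  by rewrite !indicE in_setT; case: (_ \in _).
Qed.

Lemma beta_weightT : fine (beta_weight setT) = euler_beta a b.
Proof.
rewrite /beta_weight ge0_integral_lebR//; last 2 first.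
- exact: measurable_indic_kernel.
- by move=> v; rewrite lee_fin mulr_ge0// beta_kernel_ge0.
rewrite /euler_beta /Rintegral [in RHS]integral_mkcond; congr fine.
apply: eq_integral => v _; rewrite indicT mul1r /beta_kernel patchE indicE.
by case: ifP => _; rewrite ?mul1r ?mul0r.
Qed.

Lemma beta_densityE v :
  beta_density a b v = beta_kernel v / fine (beta_weight setT).
Proof.
rewrite beta_weightT /beta_density /beta_kernel indicE.
case: ifPn => x0; last by rewrite memNset ?mul0r//= in_itv/=; exact/negP.
by rewrite mem_set ?mul1r//= in_itv/= x0.
Qed.

Lemma beta_lawE B : measurable B ->
  beta_law a b B = (beta_weight B * (fine (beta_weight setT))^-1%:E)%E.
Proof.
move=> mB; have mg := measurable_beta_kernel.
set C := (fine _)^-1.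
have C0 : 0 <= C by rewrite invr_ge0 fine_ge0// beta_weight_ge0.
rewrite /beta_law -ge0_integral_lebR//; last 2 first.
- under eq_fun do rewrite beta_densityE -/C.
  by apply: measurable_funTS; apply/measurable_EFinP; exact: measurable_funM.
- by move=> x; rewrite beta_densityE lee_fin mulr_ge0// beta_kernel_ge0.
rewrite integral_mkcond -ge0_integralZr//; last 2 first.
- exact: measurable_indic_kernel.
- by move=> s _; rewrite lee_fin mulr_ge0// beta_kernel_ge0.
apply: eq_integral => s _; rewrite patchE indicE beta_densityE -/C.
by case: ifP => _; rewrite ?mul1r ?mul0r ?mul0e// EFinM.
Qed.

End beta_weight.

Section beta_gamma.
Context {R : realType} (a b : R) (B : set R).
Hypothesis mB : measurable B.

Let F (p : R * R) : \bar R :=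
  (\1_B (p.1 / (p.1 + p.2)) * (gamma_kernel a p.1 * gamma_kernel b p.2))%:E.

Let F0 p : (0 <= F p)%E.
Proof. by rewrite lee_fin mulr_ge0// mulr_ge0 ?gamma_kernel_ge0. Qed.

Let mF : measurable_fun setT F.
Proof.
apply/measurable_EFinP; apply: measurable_funM.
  apply: (measurableT_comp (measurable_indic mB)).
  by apply: measurable_fun_div => //; exact: measurable_funD.
apply: measurable_funM.
  exact: (measurableT_comp (measurable_gamma_kernel a) measurable_fst).
exact: (measurableT_comp (measurable_gamma_kernel b) measurable_snd).
Qed.

(* The Jacobian of the change of variables is the factor [s]. The exponentials
   merge into a function of [s] alone. *)
Let F_polar s v : 0 < s -> (s%:E * F ((s * v)%R, (- (s * v) + s)%R) =
    (gamma_kernel (a + b) s)%:E * (\1_B v * beta_kernel a b v)%:E)%E.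
Proof.
move=> s0; rewrite /F /= -!EFinM; congr (_%:E).
have -> : s * v / (s * v + (- (s * v) + s)) = v.
  by rewrite addrA subrr add0r mulrAC divff ?mul1r// gt_eqF.
rewrite mulrCA [RHS]mulrCA; congr (_ * _).
have -> : - (s * v) + s = s * (1 - v) by ring.
rewrite /gamma_kernel /beta_kernel !indicE.
have -> : (s \in `]0%R, +oo[%classic) by rewrite inE/= in_itv/= s0.
have -> : (s * v \in `]0%R, +oo[%classic) = (0 < v).
  by apply/idP/idP; rewrite !inE/= in_itv/= andbT pmulr_rgt0.
have -> : (s * (1 - v) \in `]0%R, +oo[%classic) = (v < 1).
  by apply/idP/idP; rewrite !inE/= in_itv/= andbT pmulr_rgt0// subr_gt0.
have -> : (v \in `]0%R, 1%R[%classic) = (0 < v) && (v < 1).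
  by apply/idP/idP; rewrite !inE/= in_itv/=.
have [v0|_] := ltP 0 v; last by rewrite !(mul0r, mulr0).
have [v1|_] := ltP v 1; last by rewrite !(mul0r, mulr0).
rewrite /= !mul1r !powRM ?(ltW s0) ?(ltW v0)//; last by rewrite subr_ge0 ltW.
have -> : expR (- (s / 2)) = expR (- (s * v / 2)) * expR (- (s * (1 - v) / 2)).
  by rewrite -expRD; congr expR; field.
have -> : s `^ (a + b - 1) = s * s `^ (a - 1) * s `^ (b - 1).
  rewrite -{2}[s]powRr1 ?(ltW s0)// -!powRD ?(gt_eqF s0) ?implybT//.
  by congr (_ `^ _); ring.
ring.
Qed.

(** Translating [y] by [x] brings in the sum [s = x + y]; after Tonelli, scaling
    [x = s * v] at fixed [s] separates the variables. *)
Lemma gamma_ratio_weight :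
  (\int[lebR]_x \int[lebR]_y
     (\1_B (x / (x + y)) * (gamma_kernel a x * gamma_kernel b y))%:E =
   gamma_weight (a + b) setT * beta_weight a b B)%E.
Proof.
transitivity (\int[lebR]_x \int[lebR]_y F (x, y))%E; first by [].
pose F' (p : R * R) := F (p.1, - p.1 + p.2).
have mF' : measurable_fun setT F'.
  apply: measurableT_comp => //; apply: measurable_fun_pair => //.
  by apply: measurable_funD => //; exact: measurable_funN.
transitivity (\int[lebR]_x \int[lebR]_s F' (x, s))%E.
  apply: eq_integral => x _.
  have E := @ge0_integral_shift R (- x) (fun y => F (x, y))
    (measurable_fun_pair2 x mF) (fun y => F0 (x, y)).
  by rewrite -E.
rewrite (fubini_tonelli F' mF' (fun p => F0 _)).
rewrite -ge0_integralZr//; last 3 first.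
- apply/measurable_EFinP; apply: measurable_funM => //.
  exact: measurable_gamma_kernel.
- by move=> s _; rewrite lee_fin mulr_ge0// gamma_kernel_ge0.
- exact: beta_weight_ge0.
apply: eq_integral => s _; rewrite indicT mul1r.
have [s0|s0] := leP s 0.
  rewrite gamma_kernel_le0// mul0e; apply: integral0_eq => x _.
  rewrite /F' /F/=; have [x0|x0] := leP x 0.
    by rewrite (gamma_kernel_le0 a x0) !(mul0r, mulr0).
  by rewrite (@gamma_kernel_le0 _ b) ?mulr0//; lra.
have mFs := measurable_fun_pair1 s mF'.
have -> : (\int[lebR]_x F' (x, s) = s%:E * \int[lebR]_v F' ((s * v)%R, s))%E.
  rewrite (ge0_integral_scale s0 mFs (fun x => F0 _)) muleA -EFinM divff ?mul1e//.
  by rewrite gt_eqF.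
have mFsv : measurable_fun setT (fun v : R => F' ((s * v)%R, s)).
  have ms : measurable_fun setT (fun v : R => s * v) by exact: measurable_funM.
  exact: (measurableT_comp mFs ms).
have s0' : (0 <= s%:E)%E by rewrite lee_fin ltW.
rewrite -(ge0_integralZl lebR measurableT mFsv (fun v _ => F0 _) s0').
rewrite -ge0_integralZl//; last 3 first.
- apply/measurable_EFinP; apply: measurable_funM; first exact: measurable_indic.
  exact: measurable_beta_kernel.
- by move=> v _; rewrite lee_fin mulr_ge0// beta_kernel_ge0.
- by rewrite lee_fin gamma_kernel_ge0.
apply: eq_integral => v _; exact: F_polar.
Qed.
End beta_gamma.

(** * The ratio of independent Gamma variables *)

Section gamma_probability.
Context {R : realType} (a : R) (mu : {sigma_finite_measure set R -> \bar R}).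
Hypothesis muE : forall A, measurable A -> mu A = gamma_law a 2 A.
Hypothesis mu1 : mu setT = 1%E.

(** Were the integral infinite or zero, the density would be identically [0], and
    [mu] could not have mass [1]. So convergence of the Gamma integral
    comes for free from the existence of a variable with that law. *)
Lemma gamma_weight_fin :
  exists2 r : R, 0 < r & gamma_weight a (setT : set R) = r%:E.
Proof.
have := gamma_weight_ge0 a (setT : set R).
have : (gamma_weight a setT * (fine (gamma_weight a setT))^-1%:E)%E = 1%E.
  by rewrite -gamma_lawE// -muE.
case: (gamma_weight a setT) => [r||] /=.
- rewrite lee_fin -EFinM => -[r1] r0; exists r => //.
  rewrite lt_neqAle r0 andbT eq_sym; apply/eqP => rE.
  by move: r1; rewrite rE mul0r => /eqP; rewrite eq_sym oner_eq0.
- by rewrite invr0 mule0 => -[] /eqP; rewrite eq_sym oner_eq0.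
- by [].
Qed.

Lemma ge0_integral_gamma (f : R -> \bar R) : measurable_fun setT f ->
  (forall x, 0 <= f x)%E ->
  (gamma_weight a setT * \int[mu]_x f x =
   \int[lebR]_x (f x * (gamma_kernel a x)%:E))%E.
Proof.
move=> mf f0; have [r r0 rE] := gamma_weight_fin; rewrite rE.
have mk := measurable_gamma_kernel a.
have d0 x : 0 <= gamma_density a 2 x.
  by rewrite gamma_densityE rE/= mulr_ge0 ?gamma_kernel_ge0// invr_ge0 ltW.
have md : measurable_fun setT (gamma_density a 2).
  by rewrite (funext (gamma_densityE a)); exact: measurable_funM.
rewrite (@ge0_integral_density _ _ _ lebR _ (gamma_density a 2))//; last first.
  move=> A mA; apply: etrans (muE mA) _; rewrite /gamma_law ge0_integral_lebR//.
  exact/measurable_funTS/measurable_EFinP.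
have r0' : (0 <= r%:E)%E by rewrite lee_fin ltW.
rewrite -ge0_integralZl//; last 2 first.
- by apply: emeasurable_funM => //; exact/measurable_EFinP.
- by move=> x _; rewrite mule_ge0// lee_fin.
apply: eq_integral => x _; rewrite muleCA -EFinM gamma_densityE rE/=.
by rewrite mulrCA divff ?mulr1// gt_eqF.
Qed.

End gamma_probability.

Section beta_of_gammas.
Context {R : realType} (a b : R).
Variables mu nu : {sigma_finite_measure set R -> \bar R}.
Hypothesis muE : forall A, measurable A -> mu A = gamma_law a 2 A.
Hypothesis nuE : forall A, measurable A -> nu A = gamma_law b 2 A.
Hypothesis mu1 : mu setT = 1%E.
Hypothesis nu1 : nu setT = 1%E.

Let ratio (p : R * R) := p.1 / (p.1 + p.2).

Lemma measurable_ratio : measurable_fun setT ratio.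
Proof. by apply: measurable_fun_div => //; exact: measurable_funD. Qed.

Let ratio_weight B : measurable B ->
  (gamma_weight a setT * (gamma_weight b setT * (mu \x nu) (ratio @^-1` B)) =
   gamma_weight (a + b) setT * beta_weight a b B)%E.
Proof.
move=> mB; have mS := measurable_preimage measurable_ratio mB.
have m1 : measurable_fun setT (fun p : R * R => (\1_(ratio @^-1` B) p : R)%:E).
  by apply/measurable_EFinP; exact: measurable_indic.
have -> : ((mu \x nu) (ratio @^-1` B) =
    \int[mu \x nu]_p (\1_(ratio @^-1` B) p)%:E)%E.
  by rewrite integral_indic// setIT.
have i0 p : (0 <= (\1_(ratio @^-1` B) p : R)%:E)%E by rewrite lee_fin.
rewrite (fubini_tonelli1 _ m1 i0) /fubini_F.
pose f p := ((\1_(ratio @^-1` B) p : R)%:E * (gamma_kernel b p.2)%:E)%E.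
have f0 p : (0 <= f p)%E by rewrite mule_ge0// lee_fin gamma_kernel_ge0.
have mf : measurable_fun setT f.
  apply: emeasurable_funM => //; apply/measurable_EFinP.
  exact: (measurableT_comp (measurable_gamma_kernel b) measurable_snd).
pose h x := (\int[lebR]_y f (x, y))%E.
have h0 x : (0 <= h x)%E by apply: integral_ge0.
have mh : measurable_fun setT h.
  exact: (measurable_fun_fubini_tonelli_F (m2 := lebR) _ mf f0).
have inner x : (gamma_weight b setT *
    \int[nu]_y (\1_(ratio @^-1` B) (x, y) : R)%:E = h x)%E.
  exact: (ge0_integral_gamma nuE nu1 (measurable_fun_pair2 x m1) (fun y => i0 _)).
have [r r0 rE] := gamma_weight_fin nuE nu1.
have mi : measurable_fun setT
    (fun x => \int[nu]_y (\1_(ratio @^-1` B) (x, y) : R)%:E)%E.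
  exact: (measurable_fun_fubini_tonelli_F (m2 := nu) _ m1 i0).
have mi0 x (_ : setT x) : (0 <= \int[nu]_y (\1_(ratio @^-1` B) (x, y) : R)%:E)%E.
  by apply: integral_ge0 => y _; exact: i0.
transitivity (gamma_weight a setT * \int[mu]_x h x)%E.
  congr (_ * _)%E.
  apply: etrans (esym (ge0_integralZl mu measurableT mi mi0
    (gamma_weight_ge0 b setT))) _.
  by apply: eq_integral => x _; exact: inner.
apply: etrans (ge0_integral_gamma muE mu1 mh h0) _.
rewrite -gamma_ratio_weight//.
apply: eq_integral => x _.
have kx0 : (0 <= (gamma_kernel a x)%:E)%E by rewrite lee_fin gamma_kernel_ge0.
have := ge0_integralZr lebR measurableT (measurable_fun_pair2 x mf)
  (fun y _ => f0 (x, y)) kx0.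
rewrite -/(h x) => <-; apply: eq_integral => y _.
rewrite /f/= -!EFinM; congr (_%:E); rewrite -mulrA [gamma_kernel b y * _]mulrC.
by congr (_ * _); rewrite !indicE; congr ((_ _)%:R); apply/idP/idP; rewrite !inE.
Qed.

(** The factor carried by the sum of the two variables is the same for every
    event on their ratio, hence is eliminated by total mass. *)
Lemma beta_of_gammas (B : set R) : measurable B ->
  (mu \x nu)%E ((fun p : R * R => p.1 / (p.1 + p.2)) @^-1` B) = beta_law a b B.
Proof.
move=> mB; have := ratio_weight mB.
have munuT : (mu \x nu)%E setT = 1%E.
  rewrite -setXTT; apply: etrans (product_measure1E mu nu measurableT measurableT) _.
  by apply: etrans (congr2 mule mu1 nu1) _; rewrite mule1.
have : (gamma_weight a setT * gamma_weight b setT =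
    gamma_weight (a + b) setT * beta_weight a b setT)%E.
  apply: etrans _ (ratio_weight measurableT); congr (_ * _)%E.
  by apply: etrans (esym (mule1 _)) _; congr (_ * _)%E; exact: esym munuT.
have [r r0 ->] := gamma_weight_fin muE mu1.
have [s s0 ->] := gamma_weight_fin nuE nu1.
rewrite muleA -!EFinM beta_lawE// => eT eB.
have rs0 : 0 < r * s by rewrite mulr_gt0.
have [[u v] [/= u0 v0] [uE vE]] := mule_eq_fin_gt0 (gamma_weight_ge0 _ _)
  (beta_weight_ge0 _ _ _) rs0 (esym eT).
have S0 : (0 <= (mu \x nu) (ratio @^-1` B))%E by [].
have S1 : ((mu \x nu) (ratio @^-1` B) <= 1)%E.
  rewrite -munuT; apply: le_measure; rewrite ?inE//.
  exact: measurable_preimage measurable_ratio mB.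
have := @normalized_product R 1 (r * s) _ _ ((mu \x nu)%E (ratio @^-1` B))
  _ _ (lexx _) (beta_weight_le a b mB) (beta_weight_ge0 a b B)
  (gamma_weight_ge0 (a + b) setT) (gamma_weight_ge0 (a + b) setT)
  (beta_weight_ge0 a b setT) S0 S1 ltr01 rs0.
rewrite !mul1e => /(_ eT eB) ->.
by rewrite uE/= divff ?gt_eqF// mul1e.
Qed.

End beta_of_gammas.

(** * Laws and independence *)

Section density_measures.
Context {R : realType}.

Lemma ge0_density_sigma_additive (g : R -> R) : measurable_fun setT g ->
  (forall x, 0 <= g x) -> semi_sigma_additive
    (fun A : set R => \int[@lebesgue_measure R]_(x in A) (g x)%:E)%E.
Proof.
move=> mg g0 F mF tF mUF; rewrite ge0_integral_bigcup//.
- apply: is_cvg_ereal_nneg_natsum_cond => n _ _.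
  by apply: integral_ge0 => x _; rewrite lee_fin.
- exact/measurable_funTS/measurable_EFinP.
- by move=> x _; rewrite lee_fin.
Qed.

Lemma gamma_density_ge0 (a t x : R) : 0 <= gamma_density a t x.
Proof.
rewrite /gamma_density; case: ifP => // _.
rewrite !mulr_ge0 ?invr_ge0 ?mulr_ge0 ?powR_ge0 ?expR_ge0//.
apply: fine_ge0; apply: integral_ge0 => y _.
by rewrite lee_fin mulr_ge0 ?powR_ge0 ?expR_ge0.
Qed.

Lemma measurable_gamma_density (a t : R) : measurable_fun setT (gamma_density a t).
Proof.
apply: measurable_fun_if => //.
  by apply: measurable_fun_ltr.
apply: measurable_funTS; apply: measurable_funM => //; apply: measurable_funM => //.
apply: measurableT_comp => //; apply: measurable_funN; exact: measurable_funM.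
Qed.

Lemma beta_density_ge0 (a b x : R) : 0 <= beta_density a b x.
Proof.
by rewrite beta_densityE mulr_ge0 ?beta_kernel_ge0// invr_ge0 fine_ge0// beta_weight_ge0.
Qed.

Lemma measurable_beta_density (a b : R) : measurable_fun setT (beta_density a b).
Proof.
rewrite (funext (beta_densityE a b)); apply: measurable_funM => //.
exact: measurable_beta_kernel.
Qed.

Section gamma.
Variables a t : R.

Let gamma_law0 : gamma_law a t set0 = 0%E.
Proof. by rewrite /gamma_law integral_set0. Qed.

Let gamma_law_ge0 A : (0 <= gamma_law a t A)%E.
Proof. by apply: integral_ge0 => x _; rewrite lee_fin gamma_density_ge0. Qed.

HB.instance Definition _ := isMeasure.Build _ R _ (gamma_law a t)
  gamma_law0 gamma_law_ge0 (ge0_density_sigma_additive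
    (measurable_gamma_density a t) (gamma_density_ge0 a t)).
End gamma.

Section beta.
Variables a b : R.

Let beta_law0 : beta_law a b set0 = 0%E.
Proof. by rewrite /beta_law integral_set0. Qed.

Let beta_law_ge0 A : (0 <= beta_law a b A)%E.
Proof. by apply: integral_ge0 => x _; rewrite lee_fin beta_density_ge0. Qed.

HB.instance Definition _ := isMeasure.Build _ R _ (beta_law a b)
  beta_law0 beta_law_ge0 (ge0_density_sigma_additive
    (measurable_beta_density a b) (beta_density_ge0 a b)).
End beta.

End density_measures.

Section laws_and_independence.
Context {R : realType} d (T : measurableType d) (P : probability T R).

Lemma independent_comp d1 d2 d3 d4 (T1 : measurableType d1)
    (T2 : measurableType d2) (T3 : measurableType d3) (T4 : measurableType d4)
    (X : T -> T1) (Y : T -> T2) (f : T1 -> T3) (g : T2 -> T4) :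
  measurable_fun setT f -> measurable_fun setT g ->
  independent P X Y -> independent P (f \o X) (g \o Y).
Proof.
move=> mf mg XY A B mA mB.
exact: (XY _ _ (measurable_preimage mf mA) (measurable_preimage mg mB)).
Qed.

Lemma independent_sym d1 d2 (T1 : measurableType d1) (T2 : measurableType d2)
    (X : T -> T1) (Y : T -> T2) : independent P X Y -> independent P Y X.
Proof. by move=> XY A B mA mB; rewrite setIC muleC XY. Qed.

Lemma mutually_independent_comp (I : finType) (D : {pred I}) d1 d2
    (T1 : I -> measurableType d1) (T2 : I -> measurableType d2)
    (X : forall i, T -> T1 i) (f : forall i, T1 i -> T2 i) :
  (forall i, measurable_fun setT (f i)) ->
  mutually_independent P D X -> mutually_independent P D (fun i => f i \o X i).
Proof.
move=> mf indX J JD A mA.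
exact: (indX J JD _ (fun i => measurable_preimage (mf i) (mA i))).
Qed.

Lemma has_law_comp d1 d2 (T1 : measurableType d1) (T2 : measurableType d2)
    (X : T -> T1) (f : T1 -> T2) (mu : set T1 -> \bar R) :
  measurable_fun setT f -> has_law P X mu -> has_law P (f \o X) (pushforward mu f).
Proof.
move=> mf [mX XE]; split; first exact: (measurableT_comp mf mX).
by move=> A mA; exact: (XE _ (measurable_preimage mf mA)).
Qed.

Lemma has_law_eq d1 (T1 : measurableType d1) (X : T -> T1)
    (mu nu : set T1 -> \bar R) : (forall A, measurable A -> mu A = nu A) ->
  has_law P X mu -> has_law P X nu.
Proof. by move=> E [mX XE]; split => // A mA; rewrite XE// E. Qed.

Section law.
Context d1 (T1 : measurableType d1) (X : T -> T1).
Hypothesis mX : measurable_fun setT X.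

Let X_mixin := isMeasurableFun.Build _ _ _ _ _ mX.
Let X_pack : {mfun T >-> T1} := HB.pack X X_mixin.

Definition law : probability T1 R := distribution P X_pack.

Lemma lawE A : law A = pushforward P X A. Proof. by []. Qed.

End law.

(** The asymmetry comes from the product measure, which integrates against the
    first law and evaluates the second one on sections. *)
Lemma has_law_pair d1 d2 (T1 : measurableType d1) (T2 : measurableType d2)
    (X : T -> T1) (Y : T -> T2) (mu : {measure set T1 -> \bar R})
    (nu : set T2 -> \bar R) :
  has_law P X mu -> has_law P Y nu -> independent P X Y ->
  has_law P (fun w => (X w, Y w)) (mu \x nu)%E.
Proof.
move=> [mX XE] [mY YE] XY; have mXY := measurable_fun_pair mX mY.
split => // A mA; rewrite -(lawE mXY).
rewrite -(@product_measure_unique _ _ _ _ _ (law mX) (law mY))//.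
  rewrite /product_measure1.
  rewrite (eq_measure_integral mu); last by move=> B mB _; exact: XE.
  apply: eq_integral => x _ /=.
  exact: (YE _ (measurable_xsection x mA)).
Qed.

(** For fixed [B], both sides are measures in [A] which agree on rectangles, so
    each is the product of the law of [X] with a multiple of the law of [Y]. *)
Lemma independent_pairl d1 d2 d3 (T1 : measurableType d1)
    (T2 : measurableType d2) (T3 : measurableType d3)
    (X : T -> T1) (Y : T -> T2) (U : T -> T3) :
  measurable_fun setT X -> measurable_fun setT Y -> measurable_fun setT U ->
  independent P X U -> independent P (fun w => (X w, U w)) Y ->
  independent P (fun w => (X w, Y w)) U.
Proof.
move=> mX mY mU XU XUY A B mA mB; have mXY := measurable_fun_pair mX mY.
have mUB := measurable_preimage mU mB.
have c0 : 0 <= fine (P (U @^-1` B)) by rewrite fine_ge0.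
pose c := NngNum c0.
have cE : c%:num%:E = P (U @^-1` B) by rewrite fineK// fin_num_measure.
pose m2 : {sigma_finite_measure set T2 -> \bar R} := mscale c (law mY).
have indY A1 A2 B1 : measurable A1 -> measurable A2 -> measurable B1 ->
    P ((fun w => (X w, Y w)) @^-1` (A1 `*` A2) `&` U @^-1` B1) =
    (P (X @^-1` A1) * (P (U @^-1` B1) * P (Y @^-1` A2)))%E.
  move=> m1 m2' m3; rewrite muleA -XU// -(XUY (A1 `*` B1) A2)//.
    by congr (P _); apply/seteqP; split => w /=; tauto.
  exact: measurableX.
have e1 : (law mX \x m2)%E A =
    pushforward (mrestr P mUB) (fun w => (X w, Y w)) A.
  apply: product_measure_unique => // A1 A2 m1 m2'.
  by apply: etrans (indY _ _ _ m1 m2' mB) _; rewrite -cE.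
have e2 : (law mX \x m2)%E A = mscale c (law mXY) A.
  apply: product_measure_unique => // A1 A2 m1 m2'.
  have := indY A1 A2 setT m1 m2' measurableT.
  rewrite preimage_setT setIT probability_setT mul1e => e.
  by apply: etrans (congr1 (fun x => c%:num%:E * x)%E e) _; rewrite muleCA.
apply: etrans (esym e1) _; apply: etrans e2 _.
by rewrite muleC /mscale cE.
Qed.

End laws_and_independence.

(** * Polar decomposition of a Gaussian vector *)

Section total_masses.
Context {R : realType} (m : nat).
Hypothesis m0 : (0 < m)%N.

Let polarT : (@sphere_uniform_law R m setT * chi2_law m%:R setT)%E = 1%E.
Proof.
rewrite -std_normal_polar// !preimage_setT setIT; exact: std_normal_setT.
Qed.

(** A ratio [v / v] is [1] unless [v = 0], and then the product of total masses
    would be [0] instead of [1]. *)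
Lemma sphere_uniform_lawT : @sphere_uniform_law R m setT = 1%E.
Proof.
move: polarT; rewrite /sphere_uniform_law; set v := fine _.
have [->|v0] := eqVneq v 0; last by rewrite divff.
by rewrite mul0r mul0e => -[] /eqP; rewrite eq_sym oner_eq0.
Qed.

Lemma chi2_lawT : chi2_law m%:R (setT : set R) = 1%E.
Proof. by move: polarT; rewrite sphere_uniform_lawT mul1e. Qed.

End total_masses.

Section gamma_ae.
Context {R : realType} d (T : measurableType d) (P : probability T R).

Lemma gamma_law_gt0 (X : T -> R) (a : R) : has_law P X (gamma_law a 2) ->
  {ae P, forall w, 0 < X w}.
Proof.
move=> [mX XE]; apply/negligibleP.
  have := measurable_preimage mX (measurable_itv `]-oo, 0]).
  by congr measurable; apply/seteqP; split => w /=; rewrite in_itv/= leNgt => /negP.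
have -> : ~` (fun w => 0 < X w) = X @^-1` `]-oo, 0].
  by apply/seteqP; split => w /=; rewrite in_itv/= leNgt => /negP.
apply: etrans (XE _ (measurable_itv `]-oo, 0])) _.
apply: integral0_eq => x /=; rewrite in_itv/= => x0.
by rewrite /gamma_density ltNge x0.
Qed.

End gamma_ae.

Section polar_decomposition.
Context {R : realType} d (T : measurableType d) (P : probability T R).
Variables (m : nat) (Z : T -> 'rV[R]_m).
Hypothesis m0 : (0 < m)%N.
Hypothesis Z_law : has_law P Z (std_normal_law m).

Let mZ : measurable_fun setT Z. Proof. by case: Z_law. Qed.

Let QU A B : measurable A -> measurable B ->
  P ((direction \o Z) @^-1` A `&` (@sqnorm R m \o Z) @^-1` B) =
  (sphere_uniform_law m A * chi2_law m%:R B)%E.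
Proof.
move=> mA mB; rewrite -std_normal_polar// power_measureE.
case: Z_law => _ ZE; apply: (ZE (direction @^-1` A `&` @sqnorm R m @^-1` B)).
apply: measurableI; first exact: measurable_preimage (@measurable_direction R m) mA.
exact: measurable_preimage (@measurable_sqnorm R m) mB.
Qed.

Lemma direction_law : has_law P (direction \o Z) (sphere_uniform_law m).
Proof.
split; first exact: (measurableT_comp (@measurable_direction R m) mZ).
move=> A mA; have := QU mA measurableT.
by rewrite preimage_setT setIT chi2_lawT// mule1.
Qed.

Lemma sqnorm_law : has_law P (@sqnorm R m \o Z) (chi2_law m%:R).
Proof.
split; first exact: (measurableT_comp (@measurable_sqnorm R m) mZ).
move=> B mB; have := QU measurableT mB.
by rewrite preimage_setT setTI sphere_uniform_lawT// mul1e.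
Qed.

Lemma direction_sqnorm_independent :
  independent P (direction \o Z) (@sqnorm R m \o Z).
Proof.
move=> A B mA mB; rewrite QU//.
by case: direction_law sqnorm_law => [_ <-//] [_ <-].
Qed.

Section ratio.
Variables (b : R) (G : T -> R).
Hypothesis G_law : has_law P G (gamma_law b 2).
Hypothesis ZG : independent P Z G.

Notation Q := (@sqnorm R m \o Z).
Notation a := (m%:R / 2 : R).

Lemma sqnorm_pair_law :
  has_law P (fun w => (Q w, G w)) (gamma_law a 2 \x gamma_law b 2)%E.
Proof.
exact: (has_law_pair sqnorm_law G_law
  (independent_comp (@measurable_sqnorm R m) (@measurable_id _ _ _) ZG)).
Qed.

Lemma sqnorm_pair_direction_independent :
  independent P (fun w => (Q w, G w)) (direction \o Z).
Proof.
case: direction_law sqnorm_law G_law => mU _ [mQ _] [mG _].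
apply: independent_pairl => //.
  exact: independent_sym direction_sqnorm_independent.
apply: (independent_comp (f := fun z => (sqnorm z, direction z)) (g := id) _ _ ZG).
  apply: measurable_fun_pair; first exact: measurable_sqnorm.
  exact: measurable_direction.
exact: measurable_id.
Qed.

Lemma ratio_law :
  has_law P (fun w => Q w / (Q w + G w)) (beta_law a b).
Proof.
case: sqnorm_law G_law sqnorm_pair_law => mQ QE [mG GE] [mQG QGE].
have QT : law P mQ setT = 1%E by exact: probability_setT.
have GT : law P mG setT = 1%E by exact: probability_setT.
split.
  by apply: measurable_fun_div => //; exact: measurable_funD.
move=> B mB.
have -> := esym (@beta_of_gammas _ a b (law P mQ) (law P mG) QE GE QT GT _ mB).
have [mL LE] := @has_law_pair _ _ _ P _ _ _ _ Q G (law P mQ) (law P mG)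
  (conj mQ (fun _ _ => erefl)) (conj mG (fun _ _ => erefl))
  (independent_comp (@measurable_sqnorm R m) (@measurable_id _ _ _) ZG).
exact: (LE _ (measurable_preimage (@measurable_ratio R) mB)).
Qed.

(** Squaring the square root is the identity on [`]0, 1[], which carries the beta
    law. *)
Lemma radius_sqr_law :
  has_law P (fun w => Num.sqrt (Q w / (Q w + G w)) ^+ 2) (beta_law a b).
Proof.
have ms : measurable_fun setT (fun x : R => Num.sqrt x ^+ 2).
  by apply: measurable_funX; exact: measurable_sqrt.
apply: has_law_eq (has_law_comp ms ratio_law) => A mA.
rewrite /pushforward !beta_lawE//; last exact: (measurable_preimage ms mA).
congr (_ * _)%E; apply: eq_integral => v _; congr (_%:E).
rewrite /beta_kernel !indicE.
have [|_] := boolP (v \in `]0%R, 1%R[%classic); last by rewrite !(mul0r, mulr0).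
rewrite inE/= in_itv/= => /andP[v0 _]; congr ((nat_of_bool _)%:R * _).
by apply/idP/idP; rewrite !inE /preimage/= sqr_sqrtr// ltW.
Qed.

Lemma radius_sqr_direction_independent :
  independent P (fun w => Num.sqrt (Q w / (Q w + G w)) ^+ 2) (direction \o Z).
Proof.
apply: (independent_comp (f := fun p : R * R => Num.sqrt (p.1 / (p.1 + p.2)) ^+ 2)
  (g := id) _ _ sqnorm_pair_direction_independent).
  apply: measurable_funX; apply: (measurableT_comp measurable_sqrt).
  exact: measurable_ratio.
exact: measurable_id.
Qed.

Lemma radius_direction_law :
  has_law P (fun w => (Num.sqrt (Q w / (Q w + G w)), direction (Z w)))
    (pushforward (beta_law a b) Num.sqrt \x sphere_uniform_law m)%E.
Proof.
apply: has_law_pair; last 2 first.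
- exact: direction_law.
- apply: (independent_comp (f := fun p : R * R => Num.sqrt (p.1 / (p.1 + p.2)))
    (g := id) _ _ sqnorm_pair_direction_independent).
    by apply: (measurableT_comp measurable_sqrt); exact: measurable_ratio.
  exact: measurable_id.
- exact: measurable_sqrt.
- by move=> ms; exact: (has_law_comp measurable_sqrt ratio_law).
Qed.

End ratio.
End polar_decomposition.

(** * Triangular factors *)

Section factor_rows.
Context {R : realType} (n : nat).
Implicit Types (v : forall k : 'I_n, 'rV[R]_k) (e : 'I_n -> R).

Lemma lower_factor_diag v e k : lower_factor v e k k = e k.
Proof. by rewrite mxE; case: insubP => [j|]; rewrite ?ltnn// eqxx. Qed.

Lemma below_diag_lower_factor v e k : below_diag (lower_factor v e) k = v k.
Proof.
apply/rowP => j; rewrite !mxE; case: insubP => [i _ /= ij|]; last by rewrite /= ltn_ord.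
by congr (v k 0 _); apply: val_inj.
Qed.

Lemma eq_row_lower_factor v v' e e' k : v k = v' k -> e k = e' k ->
  row k (lower_factor v e) = row k (lower_factor v' e').
Proof. by move=> ev ee; apply/rowP => c; rewrite !mxE ev ee. Qed.

End factor_rows.

Section normalization.
Context {R : realType} (m : nat) (z : 'rV[R]_m) (g : R).
Notation q := (sqnorm z).
Hypotheses (q0 : 0 < q) (g0 : 0 < g).

Lemma radius_direction :
  Num.sqrt (q / (q + g)) *: ((Num.sqrt q)^-1 *: z) = (Num.sqrt (q + g))^-1 *: z.
Proof.
rewrite scalerA sqrtrM ?(ltW q0)// mulrAC divff ?mul1r ?gt_eqF ?sqrtr_gt0//.
by rewrite sqrtrV// ltW// addr_gt0.
Qed.

Lemma radius_diag :
  Num.sqrt (1 - Num.sqrt (q / (q + g)) ^+ 2) = Num.sqrt g / Num.sqrt (q + g).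
Proof.
have qg0 : 0 < q + g by rewrite addr_gt0.
rewrite sqr_sqrtr; last by rewrite divr_ge0 ?ltW.
rewrite -sqrtrV ?(ltW qg0)// -sqrtrM ?(ltW g0)//; congr Num.sqrt.
by field; rewrite gt_eqF.
Qed.

End normalization.

Theorem theorem1 (R : realType) (d : measure_display) (T : measurableType d)
    (P : probability T R) (n : nat) (eta : R)
    (Z : forall k : 'I_n, {RV P >-> 'rV[R]_k}) (G : 'I_n -> {RV P >-> R})
    (n_ge2 : (2 <= n)%N) (eta_gt0 : 0 < eta)
    (Z_law : forall k : 'I_n, (0 < k)%N -> has_law P (Z k) (std_normal_law k))
    (G_law : forall k : 'I_n, (0 < k)%N ->
       has_law P (G k) (chi2_law (n%:R + 2 * eta - k.+1%:R)))
    (ZG_indep : forall k : 'I_n, (0 < k)%N -> independent P (Z k) (G k))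
    (rows_indep : mutually_independent P [pred k : 'I_n | (0 < k)%N]
       (fun k w => (Z k w, G k w))) :
  let Q (k : 'I_n) (w : T) : R := sqnorm (Z k w) in
  let U (k : 'I_n) (w : T) : 'rV[R]_k := (Num.sqrt (Q k w))^-1 *: Z k w in
  let r (k : 'I_n) (w : T) : R := Num.sqrt (Q k w / (Q k w + G k w)) in
  let S (k : 'I_n) (w : T) : R := Num.sqrt (Q k w + G k w) in
  let L (w : T) : 'M[R]_n := bartlett_factor (Z ^~ w) (G ^~ w) in
  [/\ forall k : 'I_n, (0 < k)%N ->
      [/\ (* (i) *)
          [/\ has_law P (U k) (sphere_uniform_law k),
              has_law P (Q k) (chi2_law k%:R) &
              independent P (U k) (Q k)],
          (* (ii) *)
          [/\ has_law P (fun w => r k w ^+ 2)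
                (beta_law (k%:R / 2) (eta + (n - k.+1)%:R / 2)),
              independent P (fun w => r k w ^+ 2) (U k) &
              has_law P (fun w => (r k w, U k w)) (onion_input_law n eta k)] &
          (* (iii) *)
          {ae P, forall w,
            [/\ r k w *: U k w = (S k w)^-1 *: Z k w,
                (S k w)^-1 *: Z k w = below_diag (L w) k,
                Num.sqrt (1 - r k w ^+ 2) = Num.sqrt (G k w) / S k w,
                Num.sqrt (G k w) / S k w = L w k k &
                row k (onion_factor (r ^~ w) (U ^~ w)) = row k (L w)]}],
      mutually_independent P [pred k : 'I_n | (0 < k)%N]
        (fun k w => (Z k w, G k w, Q k w, U k w, r k w, S k w)),
      forall k : 'I_n, (0 < k)%N ->
        has_law P (fun w => (Q k w, G k w)) (gamma_ratio_law eta k),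
      gamma_ratio_inputs P eta Q G U &
      {ae P, forall w,
        gamma_ratio_onion_factor (Q ^~ w) (G ^~ w) (U ^~ w) = L w}].
Proof.
move=> Q U r S L.
have G_law' (k : 'I_n) : (0 < k)%N ->
    has_law P (G k) (gamma_law (eta + (n - k.+1)%:R / 2) 2).
  move=> k0; rewrite (_ : eta + _ = (n%:R + 2 * eta - k.+1%:R) / 2).
    exact: G_law.
  by rewrite natrB ?ltn_ord//; field.
have posQG (k : 'I_n) : (0 < k)%N -> {ae P, forall w, 0 < Q k w /\ 0 < G k w}.
  move=> k0; have [Q0 G0] := (gamma_law_gt0 (sqnorm_law k0 (Z_law k k0)),
    gamma_law_gt0 (G_law' k k0)).
  by near=> w; split; near: w.
have rowE (k : 'I_n) w : 0 < Q k w -> 0 < G k w -> (0 < k)%N ->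
    row k (onion_factor (r ^~ w) (U ^~ w)) = row k (L w).
  move=> q0 g0 k0; apply: eq_row_lower_factor; first exact: radius_direction.
  by rewrite gtn_eqF//; exact: radius_diag.
have QG_law (k : 'I_n) (k0 : (0 < k)%N) :
    has_law P (fun w => (Q k w, G k w)) (gamma_ratio_law eta k).
  exact: (sqnorm_pair_law k0 (Z_law k k0) (G_law' k k0) (ZG_indep k k0)).
have U_law (k : 'I_n) (k0 : (0 < k)%N) : has_law P (U k) (sphere_uniform_law k).
  exact: (direction_law k0 (Z_law k k0)).
split.
- move=> k k0; split.
  + split; [exact: U_law|exact: (sqnorm_law k0 (Z_law k k0))|].
    exact: (direction_sqnorm_independent k0 (Z_law k k0)).
  + split.
    * exact: (radius_sqr_law k0 (Z_law k k0) (G_law' k k0) (ZG_indep k k0)).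
    * exact: (radius_sqr_direction_independent k0 (Z_law k k0) (G_law' k k0)
        (ZG_indep k k0)).
    * exact: (radius_direction_law k0 (Z_law k k0) (G_law' k k0) (ZG_indep k k0)).
  + apply: filterS (posQG k k0) => w [q0 g0]; split.
    * exact: radius_direction.
    * by rewrite below_diag_lower_factor.
    * exact: radius_diag.
    * by rewrite lower_factor_diag gtn_eqF.
    * exact: rowE.
- have mf (k : 'I_n) : measurable_fun setT (fun p : 'rV[R]_k * R =>
      (p.1, p.2, sqnorm p.1, direction p.1,
       Num.sqrt (sqnorm p.1 / (sqnorm p.1 + p.2)), Num.sqrt (sqnorm p.1 + p.2))).
    have mq := measurableT_comp (@measurable_sqnorm R k)
      (@measurable_fst _ _ 'rV[R]_k R).
    have mqg := measurable_funD mq measurable_snd.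
    apply: measurable_fun_pair; last exact: (measurableT_comp measurable_sqrt mqg).
    apply: measurable_fun_pair; last first.
      apply: (measurableT_comp measurable_sqrt).
      exact: measurable_fun_div.
    apply: measurable_fun_pair; last first.
      exact: (measurableT_comp (@measurable_direction R k) measurable_fst).
    by apply: measurable_fun_pair => //; apply: measurable_fun_pair.
  exact: (mutually_independent_comp mf rows_indep).
- exact: QG_law.
- split.
    move=> k k0; split; [exact: QG_law|exact: U_law|].
    exact: (sqnorm_pair_direction_independent k0 (Z_law k k0) (G_law' k k0)
      (ZG_indep k k0)).
  have mf (k : 'I_n) : measurable_fun setT (fun p : 'rV[R]_k * R =>
      (sqnorm p.1, p.2, direction p.1)).
    apply: measurable_fun_pair; last first.
      exact: (measurableT_comp (@measurable_direction R k) measurable_fst).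
    apply: measurable_fun_pair => //.
    exact: (measurableT_comp (@measurable_sqnorm R k) measurable_fst).
  exact: (mutually_independent_comp mf rows_indep).
- have : {ae P, forall w (k : 'I_n), (0 < k)%N -> 0 < Q k w /\ 0 < G k w}.
    apply: filter_forall => k; have [k0|k0] := boolP (0 < k)%N.
      by apply: filterS (posQG k k0) => w.
    by apply: nearW.
  apply: filterS => w pos; apply/row_matrixP => k.
  (* Row [0] has no entry left of the diagonal, where both factors have a [1]. *)
  have [k0|k0] := posnP k; last by have [? ?] := pos k k0; exact: rowE.
  apply: eq_row_lower_factor; last by rewrite ifT ?ifT//; exact/eqP.
  by apply/rowP => j; exfalso; have := ltn_ord j; rewrite [X in (_ < X)%N]k0.
Unshelve. all: by end_near. Qed.
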